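(* There exists a transcendental shift-like map on $\mathbb{C}^3$ with escaping wandering domains. That is, there exist $\nu\in\{1,2\}$, $a\in\mathbb{C}\setminus\{0\}$ and a transcendental entire function $f:\mathbb{C}\to\mathbb{C}$ such that the map \[F:\mathbb{C}^3\to\mathbb{C}^3,\qquad F(z_1,z_2,z_3)=(z_2,z_3,\,f(z_{4-\nu})-az_1),\] has an escaping wandering domain.
   Context: A transcendental entire function is an entire function that is not a polynomial. For $N\ge2$ and $1\le\nu\le N-1$, a transcendental shift-like map of type $\nu$ on $\mathbb{C}^N$ is a map of the form $F(z_1,\dots,z_N)=(z_2,\dots,z_N,f(z_{N-\nu+1})-az_1)$ with $a\in\mathbb{C}\setminus\{0\}$ and $f$ transcendental entire; it is a biholomorphism of $\mathbb{C}^N$. Fatou set. Regard $\mathbb{C}^3\subset\mathbb{P}^3$ as the standard affine chart. For a complex manifold $X$, a family $\mathcal{F}\subset\mathrm{Hol}(X,\mathbb{P}^3)$ is $\mathbb{P}^3$-normal if every sequence in $\mathcal{F}$ has a subsequence converging uniformly on compact subsets to some element of $\mathrm{Hol}(X,\mathbb{P}^3)$. A point $z\in\mathbb{C}^3$ belongs to the ($\mathbb{P}^3$-)Fatou set of $F$ if the family of iterates $\{F^n\}_{n\geq1}$ is $\mathbb{P}^3$-normal on some neighbourhood of $z$. A Fatou component is a connected component of the Fatou set. Wandering domains. A Fatou component $U$ of $F$ is a wandering domain if $F^n(U)\neq F^m(U)$ for all integers $n>m\geq0$ (since $F$ is an automorphism, each $F^n(U)$ is a Fatou component). It is an escaping wandering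 domain if moreover the orbit of every point of $U$ escapes to infinity, i.e. $\|F^n(z)\|\to\infty$ as $n\to\infty$ for every $z\in U$. *)

(* Defs.v *)
From HB Require Import structures.
From mathcomp Require Import all_boot all_order all_algebra.
From mathcomp Require Import complex.
From mathcomp Require Import all_classical all_reals all_analysis.

Set Implicit Arguments.
Unset Strict Implicit.
Unset Printing Implicit Defensive.

Import Order.TTheory GRing.Theory Num.Theory.
Import numFieldNormedType.Exports.

Local Open Scope classical_set_scope.
Local Open Scope ring_scope.

(* The complex numbers, given by a constant of type numClosedFieldType:
   the normed-module structures of MathComp-Analysis are keyed on the structure
   projection and are not found on the bare carrier R[i].  The norm `|z| lives
   in Cplx R itself (as a nonnegative real element), and `differentiable` and
   `derivable` over Cplx R are complex differentiability. *)
Definition Cplx (R : realType) : numClosedFieldType := R[i].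

Section EntireAndShiftLike.
Variable R : realType.
Local Notation C := (Cplx R).

Definition entire (f : C -> C) : Prop := forall z : C, derivable f z 1.

Definition transcendental_entire (f : C -> C) : Prop :=
  entire f /\ ~ (exists p : {poly C}, forall z : C, f z = p.[z]).

(* On C^N with N = n.+1 and type nu, 1 <= nu <= n:
     (z_1, ..., z_N) |-> (z_2, ..., z_N, f(z_(N-nu+1)) - a z_1).
   Coordinates are numbered from 0 here, so z_(N-nu+1) has index N - nu. *)
Definition shift_like (n nu : nat) (a : C) (f : C -> C) (z : 'rV[C]_n.+1) :
    'rV[C]_n.+1 :=
  \row_(i < n.+1)
    if (i < n)%N then z 0 (inord i.+1)
    else f (z 0 (inord (n.+1 - nu))) - a * z 0 ord0.

End EntireAndShiftLike.

Section ProjectiveSpace.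
Variable R : realType.
Local Notation C := (Cplx R).

(* P^n(C): the lines through the origin of C^(n+1). *)
Definition proj (n : nat) : Type := {L : {vspace 'rV[C]_n.+1} | \dim L == 1%N}.

Lemma dim_line_neq0 n (v : 'rV[C]_n.+1) : v != 0 -> \dim <[v]> == 1%N.
Proof. by move=> v0; rewrite dim_vline v0. Qed.

Definition proj_pt n (v : 'rV[C]_n.+1) (v0 : v != 0) : proj n :=
  exist _ <[v]>%VS (dim_line_neq0 v0).

Definition homog_vec n (z : 'rV[C]_n) : 'rV[C]_n.+1 :=
  row_mx (1%:M : 'rV[C]_1) z.

Lemma homog_vec_neq0 n (z : 'rV[C]_n) : homog_vec z != 0.
Proof.
apply/eqP => /rowP /(_ (lshift n (0 : 'I_1))).
by rewrite [X in X = _](row_mxEl (1%:M : 'rV_1) z 0 0) !mxE eqxx => /eqP; rewrite oner_eq0.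
Qed.

(* C^n as the standard affine chart: (z_1, ..., z_n) |-> [1 : z_1 : ... : z_n] *)
Definition affine n (z : 'rV[C]_n) : proj n := proj_pt (homog_vec_neq0 z).

(* A choice of homogeneous coordinates; everything below is invariant under
   rescaling them. *)
Definition hcoord n (p : proj n) : 'rV[C]_n.+1 := vpick (val p).

(* The chart [w_0 : ... : w_n] |-> (w_j / w_i)_(j != i), meaningful where
   w_i != 0. *)
Definition chart n (i : 'I_n.+1) (p : proj n) : 'rV[C]_n :=
  col' i ((hcoord p 0 i)^-1 *: hcoord p).

Definition holomorphic_proj m n (X : set 'rV[C]_m) (h : 'rV[C]_m -> proj n) :
    Prop :=
  forall z, X z -> exists i : 'I_n.+1,
    \forall w \near z,
      hcoord (h w) 0 i != 0 /\ differentiable (chart i \o h) w.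

Definition hermitian_norm n (v : 'rV[C]_n) : C := sqrtC (\sum_j `|v 0 j| ^+ 2).

(* The chordal metric ||v /\ w|| / (||v|| ||w||) on P^n, i.e. the sine of the
   Fubini-Study angle between the two lines; it induces the usual topology. *)
Definition proj_dist n (p q : proj n) : C :=
  let v := hcoord p in
  let w := hcoord q in
  sqrtC (\sum_(i < n.+1) \sum_(j < n.+1 | (i < j)%N)
           `|v 0 i * w 0 j - v 0 j * w 0 i| ^+ 2)
  / (hermitian_norm v * hermitian_norm w).

Definition cvg_on_compacts m n (X : set 'rV[C]_m)
    (g : nat -> 'rV[C]_m -> proj n) (h : 'rV[C]_m -> proj n) : Prop :=
  forall K : set 'rV[C]_m, compact K -> K `<=` X ->
  forall e : C, 0 < e ->
    \forall k \near \oo, forall z, K z -> proj_dist (g k z) (h z) < e.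

(* P^n-normality on X.  Maps are total and only their values on X matter.
   Applied to constant sequences, the condition forces every member of the
   family to be holomorphic on X. *)
Definition normal_on m n (X : set 'rV[C]_m) (Fam : set ('rV[C]_m -> proj n)) :
    Prop :=
  forall g : nat -> 'rV[C]_m -> proj n, (forall k, Fam (g k)) ->
  exists (s : nat -> nat) (h : 'rV[C]_m -> proj n),
    [/\ {homo s : i j / (i < j)%N},
        holomorphic_proj X h
      & cvg_on_compacts X (g \o s) h].

End ProjectiveSpace.

Section Fatou.
Variables (R : realType) (n : nat).
Local Notation C := (Cplx R).
Implicit Types (F : 'rV[C]_n -> 'rV[C]_n) (U : set 'rV[C]_n).

Definition fatou_set F : set 'rV[C]_n :=
  [set z | exists X : set 'rV[C]_n, open_nbhs z X /\
     normal_on X [set g | exists k, (0 < k)%N /\ g = @affine R n \o iter k F]].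

Definition fatou_component F U : Prop :=
  exists2 z, fatou_set F z & U = connected_component (fatou_set F) z.

Definition wandering_domain F U : Prop :=
  fatou_component F U /\
  forall j k : nat, (j < k)%N -> iter k F @` U <> iter j F @` U.

(* `| _ | on row vectors is the sup norm, equivalent to the Euclidean one. *)
Definition escaping_wandering_domain F U : Prop :=
  wandering_domain F U /\
  forall z, U z -> `|iter k F z| @[k --> \oo] --> +oo.

End Fatou.

(* Main.v *)
Require Import Defs.
From mathcomp Require Import all_boot all_order all_algebra.
From mathcomp Require Import complex ring lra zify.
From mathcomp Require Import all_classical all_reals all_analysis.
Set Implicit Arguments.
Unset Strict Implicit.
Unset Printing Implicit Defensive.
Import Order.TTheory GRing.Theory Num.Theory.
Import numFieldNormedType.Exports.
Local Open Scope classical_set_scope.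
Local Open Scope ring_scope.

(** Take nu = 1, so that the first coordinates x_n of an orbit satisfy
    x_(n+3) = f(x_(n+2)) - a x_n.

    Choose positive reals X_n with X_(n+1) / X_n equal to 3 when n is a power
    of 2 and to 2 otherwise, and let
      f(z) = sum_m c_m exp(- (z - X_(m+2))^2),  c_m = X_(m+3) + a X_m.
    The nodes X_n are so far apart that near X_(m+2) only the m-th bump counts
    ([bumps_near]).  There f is almost equal to c_m and has an almost vanishing
    derivative, so (X_n) is nearly an orbit, and since a is small it attracts:
    a point whose first three coordinates are within a small multiple of 1 / X_n
    of X_0, X_1, X_2 keeps |x_n - X_n| below that multiple of 1 / X_n for ever
    ([shadow_orbit]).  On this cell of initial points, 1 / x_n tends to 0 and
    x_(n+1) / x_n - X_(n+1) / X_n tends to 0, uniformly.  As the ratios take two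
    values only, every sequence of iterates of order tending to infinity has a
    subsequence that converges to a constant [0 : 1 : p : p q] at infinity, so
    that the cell lies in the Fatou set ([cell_normal]).

    Let D be the set of points near which these two limits hold uniformly
    ([tracking_set]).  It is open, and it is relatively closed in the Fatou set
    ([closed_tracking_set]): let z be a Fatou point in the closure of D.
    Normality makes |x_n|^2 / (1 + |x_n|^2 + |x_(n+1)|^2 + |x_(n+2)|^2), as a
    family indexed by n, equicontinuous at z ([normal_equicontinuous]); as points of D near z have iterates close to the
    points [0 : 1 : p : p q], on a whole ball around z the functions 1 / x_n and
    x_(n+1) / x_n are bounded for large n.  They are holomorphic there and the
    quantities above tend to 0 near a point of D in that ball, so they tend to
    0 near z by the identity theorem.  Hence the Fatou component U of the cell
    lies in D.

    So all orbits in U escape, with the same asymptotic ratios.  The component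
    wanders because the pattern of ratios is aperiodic: if F^j(U) = F^k(U) with
    j < k, then the ratios at n + j and at n + k become arbitrarily close as n
    grows, but they are 3 and 2 when n + j is a large power of 2
    ([domain_wanders]).

    The identity theorem is needed only in quantitative form for explicit
    functions g having an expansion of order 2 with cubic remainder at every
    point.  The mean of |g|^2 over the four points t + s, t - s, t + is, t - is
    is at least |g(t)|^2 up to O(s^3), whence a maximum principle without
    integration ([no_local_max], [annulus_max]).  Applied to g(t) / t^p on an
    annulus it bounds g(1) by small values of g near 0 ([small_propagates]).

    Finally f is not a polynomial, since X_n is an integer multiple of a fixed
    s: for tau = i pi / s, f(z + tau) = exp(- 2 z tau - tau^2) f(z), so that the
    zeros of f are invariant under z |-> z + tau ([bumps_transcendental]). *)

(** * Complex numbers with a real-valued norm *)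

Section ComplexNumbers.
Variable R : realType.
Local Notation C := (Cplx R).

Definition ofR (x : R) : C := Complex x 0.
Definition iofR (x : R) : C := Complex 0 x.
Definition cre (z : C) : R := complex.Re z.
Definition cim (z : C) : R := complex.Im z.
(** The norm as a real number, where real arithmetic decides inequalities; the
    norm of the normed field takes its values in the complex numbers. *)
Definition cn (z : C) : R := Normc.normc z.

Lemma creD z w : cre (z + w) = cre z + cre w. Proof. by case: z w => [a b] [c d]. Qed.
Lemma cimD z w : cim (z + w) = cim z + cim w. Proof. by case: z w => [a b] [c d]. Qed.
Lemma creN z : cre (- z) = - cre z. Proof. by case: z. Qed.
Lemma cimN z : cim (- z) = - cim z. Proof. by case: z. Qed.
Lemma creM z w : cre (z * w) = cre z * cre w - cim z * cim w.
Proof. by case: z w => [a b] [c d]. Qed.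
Lemma cimM z w : cim (z * w) = cre z * cim w + cim z * cre w.
Proof. by case: z w => [a b] [c d]. Qed.
Lemma cre_ofR x : cre (ofR x) = x. Proof. by []. Qed.
Lemma cim_ofR x : cim (ofR x) = 0. Proof. by []. Qed.
Lemma cre_iofR x : cre (iofR x) = 0. Proof. by []. Qed.
Lemma cim_iofR x : cim (iofR x) = x. Proof. by []. Qed.
Lemma cre0 : cre 0 = 0. Proof. by []. Qed.
Lemma cim0 : cim 0 = 0. Proof. by []. Qed.
Lemma cim1 : cim 1 = 0. Proof. by []. Qed.

Lemma cplxP z w : cre z = cre w -> cim z = cim w -> z = w.
Proof. by case: z w => [a b] [c d] /= -> ->. Qed.

Lemma ofRD x y : ofR (x + y) = ofR x + ofR y.
Proof. by apply: cplxP; rewrite ?creD ?cimD //= addr0. Qed.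
Lemma ofRN x : ofR (- x) = - ofR x.
Proof. by apply: cplxP; rewrite ?creN ?cimN //= oppr0. Qed.
Lemma ofRM x y : ofR (x * y) = ofR x * ofR y.
Proof. by apply: cplxP; rewrite ?creM ?cimM /cre /cim /=; ring. Qed.
Lemma ofR0 : ofR 0 = 0. Proof. by []. Qed.
Lemma ofRnat n : ofR n%:R = n%:R.
Proof. by elim: n => // n IH; rewrite -[in RHS]natr1 -natr1 ofRD IH. Qed.
Lemma ofRX x n : ofR (x ^+ n) = ofR x ^+ n.
Proof. by elim: n => // n IH; rewrite !exprS ofRM IH. Qed.

Lemma normE z : `|z| = ofR (cn z). Proof. by []. Qed.
Lemma ofR_lt x y : (ofR x < ofR y) = (x < y). Proof. exact: ltcR. Qed.
Lemma ofR_le x y : (ofR x <= ofR y) = (x <= y). Proof. exact: lecR. Qed.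
Lemma ofR_inj x y : ofR x = ofR y -> x = y. Proof. by case. Qed.
Lemma posC_ofR e : 0 < e -> exists2 d : R, 0 < d & e = ofR d.
Proof.
case: e => a b H; have /andP[/eqP b0 a0] : (b == 0) && (0 < a) := H.
by exists a => //; apply: cplxP.
Qed.

Lemma cn_ge0 z : 0 <= cn z. Proof. by case: z => a b; apply: sqrtr_ge0. Qed.
Lemma cnM z w : cn (z * w) = cn z * cn w. Proof. exact: Normc.normcM. Qed.
Lemma cn0 : cn 0 = 0. Proof. exact: Normc.normc0. Qed.
Lemma cn1 : cn 1 = 1. Proof. exact: Normc.normc1. Qed.
Lemma cnV z : cn z^-1 = (cn z)^-1. Proof. exact: Normc.normcV. Qed.
Lemma cnX z n : cn (z ^+ n) = cn z ^+ n.
Proof. by elim: n => [|n IH]; rewrite ?cn1 // !exprS cnM IH. Qed.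
Lemma cnD z w : cn (z + w) <= cn z + cn w.
Proof. by rewrite -ofR_le ofRD -!normE ler_normD. Qed.
Lemma cnN z : cn (- z) = cn z.
Proof. by apply: ofR_inj; rewrite -!normE normrN. Qed.
Lemma cnB z w : cn (z - w) <= cn z + cn w.
Proof. by rewrite -(cnN w) cnD. Qed.
Lemma cnBC z w : cn (z - w) = cn (w - z).
Proof. by rewrite -cnN opprB. Qed.
Lemma cn_eq0 z : (cn z == 0) = (z == 0).
Proof. by rewrite -[RHS]normr_eq0 normE; apply/eqP/eqP => [->|/ofR_inj]. Qed.
Lemma cn_gt0 z : (0 < cn z) = (z != 0).
Proof. by rewrite lt_def cn_ge0 andbT cn_eq0. Qed.
Lemma cn_sqr z : cn z ^+ 2 = cre z ^+ 2 + cim z ^+ 2.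
Proof. by case: z => a b; rewrite sqr_sqrtr // addr_ge0 ?sqr_ge0. Qed.
Lemma cn_ofR x : cn (ofR x) = `|x|.
Proof. by rewrite /cn/= expr0n addr0 sqrtr_sqr. Qed.
Lemma cn_nat n : cn n%:R = n%:R.
Proof. by rewrite -ofRnat cn_ofR normr_nat. Qed.
Lemma cre_le z : `|cre z| <= cn z.
Proof.
rewrite -(@ler_pXn2r _ 2) ?nnegrE ?cn_ge0 // cn_sqr real_normK ?num_real //.
by rewrite lerDl sqr_ge0.
Qed.
Lemma cim_le z : `|cim z| <= cn z.
Proof.
rewrite -(@ler_pXn2r _ 2) ?nnegrE ?cn_ge0 // cn_sqr real_normK ?num_real //.
by rewrite lerDr sqr_ge0.
Qed.
Lemma cn_le z : cn z <= `|cre z| + `|cim z|.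
Proof.
have E : z = ofR (cre z) + iofR (cim z).
  by apply: cplxP; rewrite ?creD ?cimD /cre /cim /= ?addr0 ?add0r.
rewrite [in leLHS]E; apply: le_trans (cnD _ _) _.
by rewrite cn_ofR lerD2l /cn /= expr0n add0r sqrtr_sqr.
Qed.
Lemma cn_dist z w : `|cn z - cn w| <= cn (z - w).
Proof.
have H1 := cnD (z - w) w; have H2 := cnD (w - z) z.
rewrite !subrK in H1 H2; rewrite (cnBC w) in H2.
by rewrite ler_norml; apply/andP; split; lra.
Qed.

Lemma cn_bound_add x y a b : cn x <= a -> cn y <= b -> cn (x + y) <= a + b.
Proof. by move=> xa yb; apply: le_trans (cnD _ _) _; apply: lerD. Qed.
Lemma cn_bound_mul x y a b : cn x <= a -> cn y <= b -> cn (x * y) <= a * b.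
Proof. by move=> xa yb; rewrite cnM ler_pM ?cn_ge0. Qed.
End ComplexNumbers.

(** * Local expansions *)
Section Jets.
Variable R : realType.
Local Notation C := (Cplx R).
Implicit Types (g e F K : C -> C).

Definition bounded_near0 g := exists (M d : R),
  0 < d /\ forall h, cn h < d -> cn (g h) <= M.

(** A Taylor expansion c_0 + c_1 h + ... + c_(k-1) h^(k-1) + O(h^k) at 0, peeled
    off one coefficient at a time: with this recursive form, stability under the
    field operations and composition follows by induction on k, and no
    coefficient has to be computed. *)
Fixpoint jet k g : Prop := if k is k'.+1 then
  exists c e (d : R), [/\ 0 < d, forall h, cn h < d -> g h = c + h * e h & jet k' e]
  else bounded_near0 g.

Lemma jet_ext k g g' (d : R) : 0 < d -> (forall h, cn h < d -> g' h = g h) ->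
  jet k g -> jet k g'.
Proof.
move=> d0 gg'; case: k => [[M [r [r0 gM]]]|k [c [e [r [r0 ge je]]]]] /=.
  exists M, (Num.min d r); split=> [|h]; first by rewrite lt_min d0.
  by rewrite lt_min => /andP[hd hr]; rewrite gg' // gM.
exists c, e, (Num.min d r); split=> // [|h]; first by rewrite lt_min d0.
by rewrite lt_min => /andP[hd hr]; rewrite gg' // ge.
Qed.

Lemma jetS k g : jet k.+1 g -> jet k g.
Proof.
elim: k g => [|k IH] g [c [e [d [d0 ge je]]]]; last first.
  by exists c, e, d; split=> //; exact: IH.
case: je => M [r [r0 eM]].
exists (cn c + 1 * M), (Num.min (Num.min d r) 1); split=> [|h].
  by rewrite !lt_min d0 r0 ltr01.
rewrite !lt_min => /andP[/andP[hd hr] h1]; rewrite ge //.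
by apply: cn_bound_add => //; apply: cn_bound_mul; [exact: ltW | exact: eM].
Qed.

Lemma jet_leq j k g : (j <= k)%N -> jet k g -> jet j g.
Proof.
elim: k => [|k IH]; first by rewrite leqn0 => /eqP ->.
by rewrite leq_eqVlt => /predU1P[-> //|jk /jetS]; exact: IH.
Qed.

Lemma jet_cst k c : jet k (fun=> c).
Proof.
elim: k c => [|k IH] c; first by exists (cn c), 1.
by exists c, (fun=> 0), 1; split=> // h _; rewrite mulr0 addr0.
Qed.

Lemma jet_mulX k e : jet k e -> jet k.+1 (fun h => h * e h).
Proof. by move=> je; exists 0, e, 1; split=> // h _; rewrite add0r. Qed.

Lemma jet_id k : jet k id.
Proof.
apply: jetS; apply: (@jet_ext _ (fun h => h * 1) _ 1) => // [h _|].
  by rewrite mulr1.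
exact/jet_mulX/jet_cst.
Qed.

Lemma jetD k g g' : jet k g -> jet k g' -> jet k (fun h => g h + g' h).
Proof.
elim: k g g' => [|k IH] g g'.
  move=> [M [d [d0 gM]]] [M' [d' [d'0 gM']]].
  exists (M + M'), (Num.min d d'); split=> [|h]; first by rewrite lt_min d0.
  by rewrite lt_min => /andP[hd hd']; apply: cn_bound_add; [exact: gM|exact: gM'].
move=> [c [e [d [d0 ge je]]]] [c' [e' [d' [d'0 ge' je']]]].
exists (c + c'), (fun h => e h + e' h), (Num.min d d'); split=> [|h|].
- by rewrite lt_min d0.
- by rewrite lt_min => /andP[hd hd']; rewrite ge // ge' //; ring.
- exact: IH.
Qed.

Lemma jetM k g g' : jet k g -> jet k g' -> jet k (fun h => g h * g' h).
Proof.
elim: k g g' => [|k IH] g g'.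
  move=> [M [d [d0 gM]]] [M' [d' [d'0 gM']]].
  exists (M * M'), (Num.min d d'); split=> [|h]; first by rewrite lt_min d0.
  by rewrite lt_min => /andP[hd hd']; apply: cn_bound_mul; [exact: gM|exact: gM'].
move=> [c [e [d [d0 ge je]]]] jg'; have [c' [e' [d' [d'0 ge' je']]]] := jg'.
exists (c * c'), (fun h => c * e' h + e h * g' h), (Num.min d d'); split=> [|h|].
- by rewrite lt_min d0.
- rewrite lt_min => /andP[hd hd']; rewrite ge // mulrDl {1}ge' //; ring.
- by apply: jetD; apply: IH => //; [exact: jet_cst | exact: jetS].
Qed.

Lemma jetN k g : jet k g -> jet k (fun h => - g h).
Proof.
move=> jg; apply: (@jet_ext _ (fun h => (-1) * g h) _ 1) => // [h _|].
  by rewrite mulN1r.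
by apply: jetM => //; exact: jet_cst.
Qed.

Lemma jetB k g g' : jet k g -> jet k g' -> jet k (fun h => g h - g' h).
Proof. by move=> jg jg'; apply: jetD => //; exact: jetN. Qed.

Lemma jetX k g n : jet k g -> jet k (fun h => g h ^+ n).
Proof.
move=> jg; elim: n => [|n IH]; first exact: jet_cst.
apply: (@jet_ext _ (fun h => g h * g h ^+ n) _ 1) => // [h _|].
  by rewrite exprS.
exact: jetM.
Qed.

Lemma jet1_lip g : jet 1 g -> exists (M d : R),
  [/\ 0 < d, 0 <= M & forall h, cn h < d -> cn (g h - g 0) <= M * cn h].
Proof.
move=> [c [e [d [d0 ge [M [r [r0 eM]]]]]]].
exists M, (Num.min d r); split=> [||h]; first by rewrite lt_min d0.
  by apply: le_trans (eM 0 _); rewrite ?cn_ge0 ?cn0.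
rewrite lt_min => /andP[hd hr]; rewrite !ge ?cn0 // mul0r addr0 addrAC subrr add0r.
by rewrite mulrC; apply: cn_bound_mul => //; exact: eM.
Qed.

Lemma jet1_neq0 g : jet 1 g -> g 0 != 0 ->
  exists2 d : R, 0 < d & forall h, cn h < d -> cn (g 0) / 2 <= cn (g h).
Proof.
move=> /jet1_lip[M [d [d0 M0 gM]]] g0.
have q0 : 0 < cn (g 0) by rewrite cn_gt0.
exists (Num.min d (cn (g 0) / 2 / (M + 1))).
  by rewrite lt_min d0 !divr_gt0 // ltr_wpDl.
move=> h; rewrite lt_min ltr_pdivlMr ?ltr_wpDl // => /andP[hd hM].
have H := cn_dist (g h) (g 0); rewrite ler_norml in H.
have := gM h hd; case/andP: H => H _ H2.
have : cn h * (M + 1) = M * cn h + cn h by ring.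
have := cn_ge0 h; lra.
Qed.

(** If g = c + h e, then 1 / g = 1 / c - h (e / (c g)), which reduces the order
    by one. *)
Lemma jetV k g : jet k.+1 g -> g 0 != 0 -> jet k.+1 (fun h => (g h)^-1).
Proof.
move=> jg g0; have [r r0 gr] := jet1_neq0 (jet_leq (ltn0Sn k) jg) g0.
have nz h : cn h < r -> g h != 0.
  by move=> /gr H; rewrite -cn_gt0; apply: lt_le_trans H; rewrite divr_gt0 ?cn_gt0.
have key j : jet j.+1 g -> jet j (fun h => (g h)^-1) ->
    jet j.+1 (fun h => (g h)^-1).
  move=> [c [e' [d [d0 ge je]]]] jV.
  have cE : c = g 0 by rewrite ge ?cn0 // mul0r addr0.
  exists c^-1, (fun h => - c^-1 * (e' h * (g h)^-1)), (Num.min d r).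
  split=> [|h|]; first by rewrite lt_min d0.
  - rewrite lt_min => /andP[hd hr].
    have he : h * e' h = g h - c by rewrite ge // addrAC subrr add0r.
    rewrite (_ : h * _ = - c^-1 * (h * e' h) * (g h)^-1); last by ring.
    by rewrite he; field; rewrite nz // cE.
  - by apply: jetM; [exact: jet_cst | exact: jetM].
elim: k jg => [|k IH] jg; last by apply: key => //; apply/IH/jetS.
apply: key => //; exists (2 / cn (g 0)), r; split=> // h hr.
have q0 : 0 < cn (g 0) by rewrite cn_gt0.
have qh : 0 < cn (g h) by rewrite cn_gt0 nz.
by rewrite cnV -invf_div lef_pV2 ?posrE ?divr_gt0 // gr.
Qed.

(** The inner function is written h e(h), so that a vanishing value at 0 is
    built in and the induction on k passes to e. *)
Lemma jet_comp k F e : jet k F -> jet k e -> jet k (fun h => F (h * e h)).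
Proof.
elim: k F => [|k IH] F.
  move=> [M [d [d0 FM]]] [M' [r [r0 eM]]].
  exists M, (Num.min r (d / (`|M'| + 1))); split=> [|h].
    by rewrite lt_min r0 divr_gt0 // ltr_wpDl.
  rewrite lt_min ltr_pdivlMr ?ltr_wpDl // => /andP[hr hd]; apply: FM.
  apply: le_lt_trans hd; apply: cn_bound_mul => //.
  by apply: le_trans (eM _ hr) _; have := ler_norm M'; lra.
move=> [c [e' [d [d0 Fe je']]]] je.
have : jet 1 (fun h => h * e h) by apply/jet_mulX/(jet_leq _ je).
move=> /jet1_lip[M [r [r0 M0 hM]]].
exists c, (fun h => e h * e' (h * e h)), (Num.min r (d / (M + 1))); split=> [|h|].
- by rewrite lt_min r0 divr_gt0 // ltr_wpDl.
- rewrite lt_min ltr_pdivlMr ?ltr_wpDl // => /andP[hr hd]; rewrite Fe ?mulrA //.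
  have := hM h hr; rewrite mul0r subr0 => H; apply: le_lt_trans H _.
  have : cn h * (M + 1) = M * cn h + cn h by ring.
  have := cn_ge0 h; lra.
- by apply: jetM; [exact: jetS | apply: IH => //; exact: jetS].
Qed.

Definition jet_at k g t := jet k (fun h => g (t + h)).

Lemma jet_at_comp k F g t :
  jet_at k.+1 F (g t) -> jet_at k.+1 g t -> jet_at k.+1 (fun s => F (g s)) t.
Proof.
rewrite /jet_at => jF jg; have [c [e [d [d0 ge je]]]] := jg.
have cE : c = g t by rewrite -[in RHS](addr0 t) ge ?cn0 // mul0r addr0.
case: (jF) => c' [e' [r [r0 Fe je']]].
have [M [q [q0 M0 hM]]] : exists (M d : R),
  [/\ 0 < d, 0 <= M & forall h, cn h < d -> cn (h * e h) <= M * cn h].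
  have : jet 1 (fun h => h * e h) by apply/jet_mulX/(jet_leq _ je).
  by move=> /jet1_lip[M [q [q0 M0 hM]]]; exists M, q; split=> // h /hM;
    rewrite mul0r subr0.
exists c', (fun h => e h * e' (h * e h)), (Num.min d (Num.min q (r / (M + 1)))).
split=> [|h|].
- by rewrite !lt_min d0 q0 divr_gt0 // ltr_wpDl.
- rewrite !lt_min ltr_pdivlMr ?ltr_wpDl // => /and3P[hd hq hr].
  rewrite ge // cE Fe ?mulrA //; apply: le_lt_trans (hM _ hq) _.
  have : cn h * (M + 1) = M * cn h + cn h by ring.
  have := cn_ge0 h; lra.
- by apply: jetM => //; apply: jet_comp.
Qed.

End Jets.

(** * Maximum principle *)
Section MaximumPrinciple.
Variable R : realType.
Local Notation C := (Cplx R).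
Implicit Types (g : C -> C).

Lemma jet3_expansion g : jet 3 g -> exists (c1 c2 : C) (M d : R),
  [/\ 0 < d, 0 <= M & forall h, cn h < d ->
    cn (g h - (g 0 + c1 * h + c2 * h ^+ 2)) <= M * cn h ^+ 3].
Proof.
move=> [c0 [e1 [d0 [d00 ge [c1 [e2 [d1 [d10 ge1 [c2 [e3 [d2 [d20 ge2 [M [d3 [d30 eM]]]]]]]]]]]]]]].
exists c1, c2, M, (Num.min (Num.min d0 d1) (Num.min d2 d3)); split=> [||h].
- by rewrite !lt_min d00 d10 d20 d30.
- by apply: le_trans (eM 0 _); rewrite ?cn_ge0 ?cn0.
rewrite !lt_min => /andP[/andP[h0 h1] /andP[h2 h3]].
rewrite (ge 0) ?cn0 // ge // ge1 // ge2 //.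
rewrite (_ : _ - _ = e3 h * h ^+ 3); last by ring.
by rewrite cnM cnX ler_wpM2r ?exprn_ge0 ?cn_ge0 // eM.
Qed.

(** The cross terms cancel because the four points sum to 0 and so do their
    squares. *)
Lemma four_point_mean (a b c : C) (s : R) :
  let p h := cn (a + b * h + c * h ^+ 2) ^+ 2 in
  p (ofR s) + p (ofR (- s)) + p (iofR s) + p (iofR (- s)) =
  4 * (cn a ^+ 2 + cn b ^+ 2 * s ^+ 2 + cn c ^+ 2 * s ^+ 4).
Proof.
move=> p; rewrite /p !cn_sqr !expr2 !(creD, cimD, creM, cimM).
by rewrite !(cre_ofR, cim_ofR, cre_iofR, cim_iofR); ring.
Qed.

Lemma four_point_sqr (t : C) (s : R) :
  cn (t + ofR s) ^+ 2 + cn (t + ofR (- s)) ^+ 2 + cn (t + iofR s) ^+ 2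
   + cn (t + iofR (- s)) ^+ 2 = 4 * (cn t ^+ 2 + s ^+ 2).
Proof.
rewrite !cn_sqr !(creD, cimD).
by rewrite !(cre_ofR, cim_ofR, cre_iofR, cim_iofR); ring.
Qed.

Lemma cn_iofR (s : R) : cn (iofR s) = `|s|.
Proof. by rewrite /cn /= expr0n add0r sqrtr_sqr. Qed.

(** The four-point mean of |g|^2 exceeds |g(t)|^2 - O(s^3), while that of
    eps |.|^2 exceeds eps |t|^2 by eps s^2: for small s one of the four points
    wins. *)
Lemma no_local_max g (t : C) (eps d : R) : jet_at 3 g t -> 0 < eps -> 0 < d ->
  exists2 h, cn h < d &
    cn (g t) ^+ 2 + eps * cn t ^+ 2 < cn (g (t + h)) ^+ 2 + eps * cn (t + h) ^+ 2.
Proof.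
move=> /jet3_expansion[c1 [c2 [M [r [r0 M0 gM]]]]] eps0 d0; rewrite addr0 in gM.
set P := cn (g t) + cn c1 + cn c2.
have P0 : 0 <= P by rewrite !addr_ge0 ?cn_ge0.
have K0 : 0 < 2 * P * M + 1 by rewrite ltr_wpDl // !mulr_ge0.
have [s [s0 sd sr s1 sK]] : exists s : R,
    [/\ 0 < s, s < d, s < r, s <= 1 & s * (2 * P * M + 1) <= eps].
  exists (Num.min (Num.min (d / 2) (r / 2)) (Num.min 1 (eps / (2 * P * M + 1)))).
  have half (x : R) : 0 < x -> x / 2 < x by move=> ?; lra.
  split.
  - by rewrite !lt_min !divr_gt0 ?ltr01.
  - by rewrite !gt_min half.
  - by rewrite !gt_min (half r) ?orbT.
  - by rewrite !ge_min lexx ?orbT.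
  - by rewrite -ler_pdivlMr // !ge_min lexx ?orbT.
have s3 : 0 < s ^+ 3 by rewrite exprn_gt0.
apply: contrapT => none.
have ub h : cn h < d -> cn (g (t + h)) ^+ 2 + eps * cn (t + h) ^+ 2 <=
    cn (g t) ^+ 2 + eps * cn t ^+ 2.
  by move=> hd; rewrite leNgt; apply/negP => H; apply: none; exists h.
have lb h : cn h = s -> cn (g t + c1 * h + c2 * h ^+ 2) ^+ 2 - 2 * P * M * s ^+ 3
    <= cn (g (t + h)) ^+ 2.
  move=> hs; have := gM h; rewrite hs => /(_ sr).
  set p := g t + _ + _ => H.
  have pP : cn p <= P.
    apply: cn_bound_add; first apply: cn_bound_add => //.
      by rewrite cnM hs ler_piMr ?cn_ge0.
    by rewrite cnM cnX hs ler_piMr ?cn_ge0 // exprn_ile1 // ltW.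
  have H2 := cn_dist (g (t + h)) p; rewrite ler_norml in H2; case/andP: H2 => H2 _.
  have [p0 q0] := (cn_ge0 p, cn_ge0 (g (t + h))).
  have [pg|gp] := leP (cn p) (cn (g (t + h))).
    have : 0 <= 2 * P * M * s ^+ 3 by rewrite mulr_ge0 ?(ltW s3) // !mulr_ge0.
    by nra.
  have D0 : 0 <= M * s ^+ 3 by apply: le_trans H; exact: cn_ge0.
  by nra.
have [sN iN] : cn (ofR (- s) : C) = s /\ cn (iofR (- s) : C) = s.
  by rewrite cn_ofR cn_iofR normrN gtr0_norm.
have [sP iP] : cn (ofR s : C) = s /\ cn (iofR s : C) = s.
  by rewrite cn_ofR cn_iofR gtr0_norm.
have := four_point_mean (g t) c1 c2 s; have := four_point_sqr t s.
move: (lb _ sN) (lb _ iN) (lb _ sP) (lb _ iP).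
move: (ub (ofR (- s))) (ub (iofR (- s))) (ub (ofR s)) (ub (iofR s)).
rewrite sN iN sP iP /= => /(_ sd) u1 /(_ sd) u2 /(_ sd) u3 /(_ sd) u4 l1 l2 l3 l4 E1 E2.
have b0 : 0 <= cn c1 ^+ 2 * s ^+ 2 + cn c2 ^+ 2 * s ^+ 4.
  by rewrite addr_ge0 ?mulr_ge0 ?exprn_ge0 ?cn_ge0 // ltW.
have fin : 2 * P * M * s ^+ 3 + s ^+ 3 <= eps * s ^+ 2.
  have -> : 2 * P * M * s ^+ 3 + s ^+ 3 = s * (2 * P * M + 1) * s ^+ 2 by ring.
  by rewrite ler_wpM2r // exprn_ge0 // ltW.
have E1' : eps * cn (t + ofR s) ^+ 2 + eps * cn (t + ofR (- s)) ^+ 2 +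
   eps * cn (t + iofR s) ^+ 2 + eps * cn (t + iofR (- s)) ^+ 2 =
   4 * (eps * cn t ^+ 2 + eps * s ^+ 2) by rewrite -!mulrDr E1; ring.
move: E1' E2 u1 u2 u3 u4 l1 l2 l3 l4 fin b0 => {none ub lb E1}.
set A := cn (g t) ^+ 2; set T := eps * cn t ^+ 2; set S2 := eps * s ^+ 2.
lra.
Qed.

End MaximumPrinciple.

Section AnnulusMaximum.
Variable R : realType.
Local Notation C := (Cplx R).
Implicit Types (g : C -> C).

(** Compactness and extrema are taken in the real plane, through this map. *)
Definition cplx (p : R * R) : C := Complex p.1 p.2.

Lemma cplx_dist p q : cn (cplx q - cplx p) <= `|q.1 - p.1| + `|q.2 - p.2|.
Proof. by apply: le_trans (cn_le _) _; rewrite creD cimD creN cimN. Qed.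

Lemma cont_at_pair (f : R * R -> R) p :
  (forall e : R, 0 < e -> exists2 d : R, 0 < d & forall q,
     cn (cplx q - cplx p) < d -> `|f p - f q| <= e) -> {for p, continuous f}.
Proof.
move=> H; apply/(@cvgrPdist_le _ R^o) => e e0; have [d d0 Hd] := H e e0.
exists (ball p.1 (d / 2), ball p.2 (d / 2)) => /=.
  by split; apply: nbhsx_ballx; rewrite divr_gt0.
move=> q [/= q1 q2]; apply: Hd; apply: le_lt_trans (cplx_dist _ _) _.
rewrite /ball /= in q1 q2; rewrite (distrC q.1) (distrC q.2).
lra.
Qed.

Lemma cont_cn_jet g p : jet_at 1 g (cplx p) ->
  {for p, continuous (fun q => cn (g (cplx q)))}.
Proof.
move=> /jet1_lip[M [d [d0 M0 gM]]]; apply: cont_at_pair => e e0.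
exists (Num.min d (e / (M + 1))); first by rewrite lt_min d0 divr_gt0 // ltr_wpDl.
move=> q; rewrite lt_min ltr_pdivlMr ?ltr_wpDl // => /andP[qd qe].
rewrite distrC; apply: le_trans (cn_dist _ _) _.
have := gM _ qd; rewrite addr0 [cplx p + _]addrC subrK => H; apply: le_trans H _.
have : cn (cplx q - cplx p) * (M + 1) = M * cn (cplx q - cplx p) + cn (cplx q - cplx p)
  by ring.
have := cn_ge0 (cplx q - cplx p); lra.
Qed.

Lemma jet_at_id k (t : C) : jet_at k id t.
Proof. by apply: jetD; [exact: jet_cst | exact: jet_id]. Qed.

Lemma continuous_cn_cplx : continuous (fun q => cn (cplx q)).
Proof. by move=> p; apply: (@cont_cn_jet id); exact: jet_at_id. Qed.

Lemma compact_annulus (a b : R) :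
  compact [set p : R * R | a <= cn (cplx p) <= b].
Proof.
apply: (@subclosed_compact _ _ (`[- b, b] `*` `[- b, b])).
- have -> : [set p : R * R | a <= cn (cplx p) <= b] =
     (fun q => cn (cplx q)) @^-1` `[a, b].
    by apply/seteqP; split => p /=; rewrite in_itv.
  apply: closed_comp; last exact: interval_closed.
  by move=> p _; exact: continuous_cn_cplx.
- by apply: compact_setX; exact: segment_compact.
- move=> p /= /andP[_ pb]; rewrite !in_itv /= -!ler_norml; split.
    exact: le_trans (cre_le (cplx p)) pb.
  exact: le_trans (cim_le (cplx p)) pb.
Qed.

(** The perturbation eps |t|^2 forces the maximum of |g|^2 + eps |t|^2 onto the
    boundary; then eps tends to 0. *)
Lemma annulus_max g (a b B : R) : 0 <= B ->
  (forall t, a <= cn t <= b -> jet_at 3 g t) ->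
  (forall t, cn t = a \/ cn t = b -> cn (g t) <= B) ->
  forall t, a <= cn t <= b -> cn (g t) <= B.
Proof.
move=> B0 jg gB t tab.
rewrite -(@ler_pXn2r _ 2) ?nnegrE ?cn_ge0 //.
apply/ler_addgt0Pr => e e0.
have b0 : 0 <= b by case/andP: tab => _; apply: le_trans; exact: cn_ge0.
set eps := e / (b ^+ 2 + 1).
have K0 : 0 < b ^+ 2 + 1 by rewrite ltr_wpDl // exprn_ge0.
have eps0 : 0 < eps by rewrite divr_gt0.
pose A := [set p : R * R | a <= cn (cplx p) <= b].
pose f p := cn (g (cplx p)) ^+ 2 + eps * cn (cplx p) ^+ 2.
have A0 : A !=set0 by exists (cre t, cim t); rewrite /A /=; case: (t) tab.
have fA : {within A, continuous f}.
  apply: continuous_in_subspaceT => p; rewrite inE => pA.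
  have c1 := cont_cn_jet (jet_leq (isT : (1 <= 3)%N) (jg _ pA)).
  have c2 := @continuous_cn_cplx p.
  apply: (@cvgD _ R^o _ _ _ (fun q => cn (g (cplx q)) ^+ 2)
    (fun q => eps * cn (cplx q) ^+ 2)); first exact: (cvgM c1 c1).
  by apply: cvgM; [exact: cvg_cst | exact: (cvgM c2 c2)].
have [p] := compact_EVT_max A0 (@compact_annulus a b) fA.
rewrite inE => pA pmax.
have bound : f p <= B ^+ 2 + e.
  have pb : eps * cn (cplx p) ^+ 2 <= e.
    rewrite -[leRHS](divfK (lt0r_neq0 K0)) ler_pM2l //.
    have : cn (cplx p) ^+ 2 <= b ^+ 2.
      by rewrite ler_pXn2r ?nnegrE ?cn_ge0 //; case/andP: pA.
    lra.
  have [bd|nbd] := pselect (cn (cplx p) = a \/ cn (cplx p) = b).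
    by rewrite lerD // ler_pXn2r ?nnegrE ?cn_ge0 // gB.
  exfalso; have [pa pb'] : a < cn (cplx p) /\ cn (cplx p) < b.
    case/andP: pA => p1 p2; rewrite !lt_neqAle p1 p2 !andbT; split;
    by apply/eqP => E; apply: nbd; rewrite E; tauto.
  pose d := Num.min (cn (cplx p) - a) (b - cn (cplx p)).
  have d0 : 0 < d by rewrite lt_min !subr_gt0 pa.
  have [h hd] := no_local_max (jg _ pA) eps0 d0.
  pose q : R * R := (cre (cplx p + h), cim (cplx p + h)).
  have qE : cplx q = cplx p + h by rewrite /q; case: (cplx p + h).
  have fq : f q = cn (g (cplx p + h)) ^+ 2 + eps * cn (cplx p + h) ^+ 2.
    by rewrite /f qE.
  rewrite -fq ltNge pmax //; rewrite inE; change (is_true (a <= cn (cplx q) <= b)); rewrite qE.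
  have := cn_dist (cplx p + h) (cplx p); rewrite addrAC subrr add0r ler_norml.
  move: hd; rewrite lt_min => /andP[h1 h2] /andP[h3 h4].
  by apply/andP; split; lra.
apply: le_trans bound; apply: le_trans (pmax (cre t, cim t) _).
  rewrite /f (_ : cplx (cre t, cim t) = t); last by case: (t).
  by rewrite lerDl mulr_ge0 ?exprn_ge0 ?cn_ge0 // ltW.
by rewrite inE /A /=; case: (t) tab.
Qed.

(** Dividing by a high power of the variable turns the maximum principle on an
    annulus into a quantitative identity theorem. *)
Lemma small_propagates g (tau eta M : R) (p : nat) :
  0 < tau -> tau <= 1 -> 0 <= eta -> 0 <= M ->
  (forall t, cn t <= 2 -> jet_at 3 g t) ->
  (forall t, cn t <= tau -> cn (g t) <= eta) ->
  (forall t, cn t <= 2 -> cn (g t) <= M) ->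
  cn (g 1) <= eta / tau ^+ p + M / 2 ^+ p.
Proof.
move=> tau0 tau1 eta0 M0 jg g1 g2.
have nz (t : C) : tau <= cn t <= 2 -> t != 0.
  by move=> /andP[t1 _]; rewrite -cn_gt0; exact: lt_le_trans t1.
have K1 : 0 <= eta / tau ^+ p by rewrite divr_ge0 // exprn_ge0 // ltW.
have K2 : 0 <= M / 2 ^+ p by rewrite divr_ge0 // exprn_ge0.
have E (t : C) : cn (g t * (t ^+ p)^-1) = cn (g t) / cn t ^+ p.
  by rewrite cnM cnV cnX.
have := @annulus_max (fun t => g t * (t ^+ p)^-1) tau 2 (eta / tau ^+ p + M / 2 ^+ p).
move=> /(_ _ _ _ 1); rewrite expr1n invr1 mulr1; apply.
- exact: addr_ge0.
- move=> t tA; apply: jetM; first by apply: jg; case/andP: tA.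
  apply: (@jetV _ _ (fun h => (t + h) ^+ p)); last by rewrite addr0 expf_neq0 // nz.
  by apply: (@jetX _ _ (fun h => t + h)); exact: (jet_at_id 3 t).
- move=> t [tE|tE]; rewrite E tE.
    apply: le_trans (_ : eta / tau ^+ p <= _); last by rewrite lerDl.
    by rewrite ler_wpM2r ?invr_ge0 ?exprn_ge0 ?(ltW tau0) // g1 ?tE.
  apply: le_trans (_ : M / 2 ^+ p <= _); last by rewrite lerDr.
  by rewrite ler_wpM2r ?invr_ge0 ?exprn_ge0 // g2 ?tE.
- by rewrite cn1 tau1 /=; lra.
Qed.

End AnnulusMaximum.

(** * The complex exponential *)
Section ComplexExponential.
Variable R : realType.
Local Notation C := (Cplx R).

Definition cexp (z : C) : C :=
  Complex (expR (cre z) * cos (cim z)) (expR (cre z) * sin (cim z)).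

Lemma cexpD z w : cexp (z + w) = cexp z * cexp w.
Proof.
apply: cplxP; rewrite ?creM ?cimM /cexp /cre /cim /= -/(cre _) -/(cim _).
  by rewrite creD cimD expRD cosD; ring.
by rewrite creD cimD expRD sinD; ring.
Qed.

Lemma cn_cexp z : cn (cexp z) = expR (cre z).
Proof.
apply/eqP; rewrite -(@eqrXn2 _ 2) ?cn_ge0 ?expR_ge0 //; apply/eqP.
rewrite cn_sqr /cexp {1}/cre {2}/cim /=.
by rewrite !exprMn -mulrDr cos2Dsin2 mulr1.
Qed.

Lemma cexp0 : cexp 0 = 1.
Proof. by rewrite /cexp cre0 cim0 expR0 cos0 sin0 mul1r mulr0. Qed.

Lemma cexp_ofR x : cexp (ofR x) = ofR (expR x).
Proof. by rewrite /cexp cre_ofR cim_ofR cos0 sin0 mulr1 mulr0. Qed.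

Lemma mean_value_bound (f df : R -> R) (B t : R) : 0 <= t ->
  (forall x : R, is_derive x 1 f (df x)) ->
  (forall x, 0 <= x <= t -> `|df x| <= B) -> f 0 = 0 -> `|f t| <= B * t.
Proof.
move=> t0 fd dB f0.
have cf : {within `[0, t], continuous f}.
  apply: continuous_subspaceT => x.
  by have [d _] := fd x; apply: differentiable_continuous; apply/derivable1_diffP.
have [c] := @MVT_segment _ f df 0 t t0 (fun x _ => fd x) cf.
rewrite in_itv /= f0 !subr0 => cI ->.
by rewrite normrM (ger0_norm t0) ler_wpM2r // dB.
Qed.

(** Along the ray t |-> exp (t (a + i b)), each remainder has the previous one,
    multiplied by a + i b, as its derivative: three applications of the mean
    value inequality bound the cubic remainder. *)
Section AlongRay.
Variables a b : R.
Let P (t : R) := expR (t * a) * cos (t * b).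
Let Q (t : R) := expR (t * a) * sin (t * b).

Let is_derive_scale (c t : R) : is_derive t 1 (fun t : R => t * c) c.
Proof. by apply: is_derive_eq; rewrite scaler0 add0r /GRing.scale/= mulr1. Qed.

Let derive_exp (t : R) : is_derive t 1 (expR \o (fun t : R => t * a))
  (expR (t * a) * a).
Proof. exact: is_derive1_comp. Qed.

Lemma ray_derive_cos (t : R) : is_derive t 1 P (a * P t - b * Q t).
Proof.
have e2 : is_derive t 1 (@cos R \o (fun t : R => t * b)) (- sin (t * b) * b).
  exact: is_derive1_comp.
have H := is_deriveM (derive_exp t) e2.
by apply: (is_derive_eq H); rewrite /P /Q /GRing.scale /=; ring.
Qed.

Lemma ray_derive_sin (t : R) : is_derive t 1 Q (a * Q t + b * P t).
Proof.
have e2 : is_derive t 1 (@sin R \o (fun t : R => t * b)) (cos (t * b) * b).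
  exact: is_derive1_comp.
have H := is_deriveM (derive_exp t) e2.
by apply: (is_derive_eq H); rewrite /P /Q /GRing.scale /=; ring.
Qed.

Let is_derive_sqr (c t : R) : is_derive t 1 (fun t : R => t ^+ 2 * c) (2 * t * c).
Proof.
by apply: is_derive_eq; rewrite scaler0 add0r /GRing.scale /=; ring.
Qed.

Let ray_step (u v u' v' : R -> R) (W B : R) :
  (forall t : R, is_derive t 1 u' (a * u t - b * v t)) ->
  (forall t : R, is_derive t 1 v' (a * v t + b * u t)) ->
  u' 0 = 0 -> v' 0 = 0 -> `|a| <= W -> `|b| <= W -> 0 <= B ->
  (forall t, 0 <= t <= 1 -> `|u t| <= B /\ `|v t| <= B) ->
  forall t, 0 <= t <= 1 -> `|u' t| <= 2 * W * B /\ `|v' t| <= 2 * W * B.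
Proof.
move=> du dv u0 v0 aW bW B0 uv t /andP[t0 t1].
have W0 : 0 <= W by apply: le_trans aW.
have K0 : 0 <= 2 * W * B by rewrite !mulr_ge0.
have prod (x y : R) : `|x| <= W -> `|y| <= B -> `|x * y| <= W * B.
  by move=> xW yB; rewrite normrM ler_pM.
have main (f df : R -> R) : (forall t : R, is_derive t 1 f (df t)) -> f 0 = 0 ->
    (forall x, 0 <= x <= 1 -> `|df x| <= 2 * W * B) -> `|f t| <= 2 * W * B.
  move=> fd f0 dB; have H := @mean_value_bound f df (2 * W * B) t t0 fd _ f0.
  apply: (le_trans (H _)); last by rewrite ler_piMr.
  by move=> x /andP[x0 xt]; rewrite dB // x0 (le_trans xt).
split; [apply: (main _ _ du u0) | apply: (main _ _ dv v0)] => x /uv[ux vx].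
  apply: le_trans (ler_normB _ _) _.
  by have := prod _ _ aW ux; have := prod _ _ bW vx; lra.
apply: le_trans (ler_normD _ _) _.
by have := prod _ _ aW vx; have := prod _ _ bW ux; lra.
Qed.

Lemma ray_taylor (W : R) : `|a| <= W -> `|b| <= W ->
  `|P 1 - 1 - a - (a ^+ 2 - b ^+ 2) / 2| <= 8 * W ^+ 3 * expR W /\
  `|Q 1 - b - a * b| <= 8 * W ^+ 3 * expR W.
Proof.
move=> aW bW; have W0 : 0 <= W by apply: le_trans aW.
have E0 := expR_ge0 W.
have b0 t : 0 <= t <= 1 -> `|P t| <= expR W /\ `|Q t| <= expR W.
  move=> /andP[t0 t1].
  have e : expR (t * a) <= expR W.
    rewrite ler_expR; apply: le_trans (ler_norm _) _.
    by rewrite normrM (ger0_norm t0) -[leRHS]mul1r ler_pM.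
  rewrite !normrM (ger0_norm (expR_ge0 _)) -[in X in _ /\ X](mulr1 (expR W)).
  rewrite -[X in _ <= X /\ _](mulr1 (expR W)).
  by split; rewrite ler_pM ?expR_ge0 // ?cos_max ?sin_max.
pose u1 t := P t - 1.
pose u2 t := P t - 1 - t * a.
pose u3 t := P t - 1 - t * a - t ^+ 2 * ((a ^+ 2 - b ^+ 2) / 2).
pose v2 t := Q t - t * b.
pose v3 t := Q t - t * b - t ^+ 2 * (a * b).
have P0 : P 0 = 1 by rewrite /P !mul0r expR0 cos0 mulr1.
have Q0 : Q 0 = 0 by rewrite /Q !mul0r expR0 sin0 mulr0.
have du1 (t : R) : is_derive t 1 u1 (a * P t - b * Q t).
  have H := is_deriveB (ray_derive_cos t) (is_derive_cst (1 : R) t 1).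
  by apply: (is_derive_eq H); rewrite subr0.
have du2 (t : R) : is_derive t 1 u2 (a * u1 t - b * Q t).
  have H := is_deriveB (du1 t) (is_derive_scale a t).
  by apply: (is_derive_eq H); rewrite /u1; ring.
have dv2 (t : R) : is_derive t 1 v2 (a * Q t + b * u1 t).
  have H := is_deriveB (ray_derive_sin t) (is_derive_scale b t).
  by apply: (is_derive_eq H); rewrite /u1; ring.
have du3 (t : R) : is_derive t 1 u3 (a * u2 t - b * v2 t).
  have H := is_deriveB (du2 t) (is_derive_sqr ((a ^+ 2 - b ^+ 2) / 2) t).
  by apply: (is_derive_eq H); rewrite /u1 /u2 /v2; field.
have dv3 (t : R) : is_derive t 1 v3 (a * v2 t + b * u2 t).
  have H := is_deriveB (dv2 t) (is_derive_sqr (a * b) t).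
  by apply: (is_derive_eq H); rewrite /u1 /u2 /v2; ring.
have K1 : 0 <= 2 * W * expR W by rewrite !mulr_ge0.
have K2 : 0 <= 2 * W * (2 * W * expR W) by rewrite !mulr_ge0.
have u10 : u1 0 = 0 by rewrite /u1 P0 subrr.
have u20 : u2 0 = 0 by rewrite /u2 P0 mul0r; ring.
have v20 : v2 0 = 0 by rewrite /v2 Q0 mul0r subrr.
have u30 : u3 0 = 0 by rewrite /u3 P0 expr0n /= !mul0r; ring.
have v30 : v3 0 = 0 by rewrite /v3 Q0 expr0n /= !mul0r; ring.
have s1 := ray_step du1 ray_derive_sin u10 Q0 aW bW E0 b0.
have s2 := ray_step du2 dv2 u20 v20 aW bW K1 s1.
have [] := ray_step du3 dv3 u30 v30 aW bW K2 s2 (t := 1).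
  by rewrite ler01 lexx.
have -> : 2 * W * (2 * W * (2 * W * expR W)) = 8 * W ^+ 3 * expR W by ring.
by rewrite /u3 /v3 !mul1r expr1n !mul1r.
Qed.

End AlongRay.

Definition cexp_tail (w : C) : C := (cexp w - 1 - w - w ^+ 2 / 2) / w ^+ 3.

Lemma cexp_taylor w : cexp w = 1 + w + w ^+ 2 / 2 + w ^+ 3 * cexp_tail w.
Proof.
have [->|w0] := eqVneq w 0; first by rewrite cexp0 !expr0n /= !mul0r !addr0.
by rewrite /cexp_tail; field.
Qed.

Lemma cn_cexp_tail w : cn (cexp_tail w) <= 16 * expR (cn w).
Proof.
have K := expR_ge0 (cn w).
have [->|w0] := eqVneq w 0.
  by rewrite /cexp_tail [0 ^+ 3]exprS mul0r invr0 mulr0 cn0 mulr_ge0 // expR_ge0.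
have W0 : 0 < cn w ^+ 3 by rewrite exprn_gt0 // cn_gt0.
rewrite /cexp_tail cnM cnV cnX ler_pdivrMr //.
have [] := ray_taylor (cre_le w) (cim_le w); rewrite !mul1r => re im.
apply: le_trans (cn_le _) _.
have half (z : C) : cre (z / 2) = cre z / 2 /\ cim (z / 2) = cim z / 2.
  have -> : (2 : C)^-1 = ofR 2^-1.
    apply: (mulfI (_ : (2 : C) != 0)); first by rewrite pnatr_eq0.
    by rewrite divff ?pnatr_eq0 // -[2 : C]ofRnat -ofRM divff.
  by rewrite creM cimM cre_ofR cim_ofR !mulr0 subr0 add0r mulrC.
have [h1 h2] := half (w ^+ 2).
have -> : cre (cexp w - 1 - w - w ^+ 2 / 2) =
   expR (cre w) * cos (cim w) - 1 - cre w - (cre w ^+ 2 - cim w ^+ 2) / 2.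
  by rewrite !creD !creN h1 expr2 creM.
have -> : cim (cexp w - 1 - w - w ^+ 2 / 2) =
   expR (cre w) * sin (cim w) - cim w - cre w * cim w.
  by rewrite !cimD !cimN h2 expr2 cimM cim1 {1}/cim /=; field.
lra.
Qed.

End ComplexExponential.

(** * Dominated complex series *)
Section DominatedSeries.
Variable R : realType.
Local Notation C := (Cplx R).
Implicit Types (u v : nat -> C) (B : R).

Definition dominated u B := forall k, cn (u k) <= B / 2 ^+ k.

Definition csum u : C :=
  Complex (limn (series (fun k => cre (u k)))) (limn (series (fun k => cim (u k)))).

Lemma geometric_half_cvg B :
  series (fun k => B / 2 ^+ k) @ \oo --> (2 * B : R^o).
Proof.
have := @cvg_geometric_series R B 2^-1.
rewrite ger0_norm ?invr_ge0 // => /(_ _); rewrite invf_lt1 ?ltr1n // => /(_ isT).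
rewrite (_ : B * _ = 2 * B); last by field.
rewrite (_ : geometric _ _ = fun k => B / 2 ^+ k) //.
by apply/funext => k; rewrite /= exprVn.
Qed.

Lemma dominated_real (u : nat -> R) B : (forall k, `|u k| <= B / 2 ^+ k) ->
  cvgn (series u) /\ `|limn (series u)| <= 2 * B.
Proof.
move=> uB; have gc := @geometric_half_cvg B.
have nc : cvgn [normed series u].
  apply: (series_le_cvg _ _ uB) => [k|k|]; first by [].
    by apply: le_trans (uB k).
  by apply/cvg_ex; exists (2 * B).
split; first exact: (@normed_cvg _ R^o).
apply: le_trans (@lim_series_norm _ R^o _ nc) _.
rewrite -(cvg_lim _ gc) //.
by apply: lim_series_le => //; apply/cvg_ex; exists (2 * B).
Qed.

Lemma dominated_re u B k : dominated u B -> `|cre (u k)| <= B / 2 ^+ k.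
Proof. by move=> uB; apply: le_trans (cre_le _) (uB k). Qed.
Lemma dominated_im u B k : dominated u B -> `|cim (u k)| <= B / 2 ^+ k.
Proof. by move=> uB; apply: le_trans (cim_le _) (uB k). Qed.

Lemma csum_bound u B : dominated u B -> cn (csum u) <= 4 * B.
Proof.
move=> uB; apply: le_trans (cn_le _) _; rewrite /csum {1}/cre {2}/cim /=.
have [_ h1] := dominated_real (fun k => dominated_re k uB).
have [_ h2] := dominated_real (fun k => dominated_im k uB).
by rewrite (_ : 4 * B = 2 * B + 2 * B); [apply: lerD | ring].
Qed.

Lemma csumD u v B B' : dominated u B -> dominated v B' ->
  csum (fun k => u k + v k) = csum u + csum v.
Proof.
move=> uB vB.
have [h1 _] := dominated_real (fun k => dominated_re k uB).
have [h2 _] := dominated_real (fun k => dominated_im k uB).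
have [h3 _] := dominated_real (fun k => dominated_re k vB).
have [h4 _] := dominated_real (fun k => dominated_im k vB).
apply: cplxP; rewrite ?creD ?cimD /csum /cre /cim /= -/(cre _) -/(cim _).
  rewrite -lim_seriesD //; congr (limn (series _)).
  by apply/funext => k; rewrite -/(cre _) creD.
rewrite -lim_seriesD //; congr (limn (series _)).
by apply/funext => k; rewrite -/(cim _) cimD.
Qed.

Lemma csumZ u c B : dominated u B -> csum (fun k => c * u k) = c * csum u.
Proof.
move=> uB.
have [h1 _] := dominated_real (fun k => dominated_re k uB).
have [h2 _] := dominated_real (fun k => dominated_im k uB).
have Z (w : nat -> R) a : cvgn (series w) ->
    cvgn (series (a *: (w : nat -> R^o))) /\
    limn (series (a *: (w : nat -> R^o))) = a * limn (series w).
  by move=> cw; split; [exact: is_cvg_seriesZ | rewrite lim_seriesZ].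
have [r1 l1] := Z _ (cre c) h1; have [r2 l2] := Z _ (cim c) h1.
have [r3 l3] := Z _ (cre c) h2; have [r4 l4] := Z _ (cim c) h2.
apply: cplxP.
  rewrite creM {2}/csum {2}/csum [cre (Complex _ _)]/= [cim (Complex _ _)]/=.
  rewrite /cre /cim /= -/(cre _) -/(cim _) -l1 -l4 -lim_seriesB //.
  congr (limn (series _)); apply/funext => k.
  by rewrite -/(cre _) creM.
rewrite cimM {2}/csum {2}/csum [cre (Complex _ _)]/= [cim (Complex _ _)]/=.
rewrite /cre /cim /= -/(cre _) -/(cim _) -l3 -l2 -lim_seriesD //.
congr (limn (series _)); apply/funext => k.
by rewrite -/(cim _) cimM.
Qed.

(** Used to isolate the leading term of a series. *)
Lemma csum_single m c : csum (fun k => if k == m then c else 0) = c.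
Proof.
have S (x : R) : limn (series (fun k => if k == m then x else 0)) = x.
  apply/cvg_lim => //; apply: cvg_near_cst; exists m.+1 => // n /= mn.
  rewrite /series /= (bigD1_seq m) ?mem_index_iota ?iota_uniq //= eqxx.
  by rewrite big1 ?addr0 // => i /negbTE ->.
apply: cplxP; rewrite /csum /cre /cim /= -/(cre _) -/(cim _).
  by rewrite -[RHS]S; congr (limn (series _)); apply/funext => k; case: ifP.
by rewrite -[RHS]S; congr (limn (series _)); apply/funext => k; case: ifP.
Qed.

End DominatedSeries.

(** * The nodes *)
Definition is_pow2 (n : nat) : bool := n == (2 ^ trunc_log 2 n)%N.

Lemma is_pow2_exp i : is_pow2 (2 ^ i).
Proof. by rewrite /is_pow2 trunc_expnK. Qed.

(** The gaps between powers of 2 grow, so a shift of the set of powers of 2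
    eventually misses it: this is the source of aperiodicity. *)
Lemma is_pow2_between i k : (0 < k < 2 ^ i)%N -> ~~ is_pow2 (2 ^ i + k).
Proof.
move=> /andP[k0 ki]; rewrite /is_pow2 (@trunc_log_eq 2 i) //.
  by rewrite -[X in _ == X]addn0 eqn_add2l -lt0n.
by rewrite leq_addr expnS mul2n -addnn ltn_add2l.
Qed.

Definition growth (n : nat) : nat := if is_pow2 n then 3 else 2.

Fixpoint mult (n : nat) : nat := if n is n'.+1 then (growth n' * mult n')%N else 1%N.

Section Sequence.
Variable R : realType.

(** Every node is an integer multiple of this number, which makes the series of
    bumps quasi-periodic.  It is large enough for the bumps to be separated to
    the accuracy needed in [bumps_near], and locked to keep conversion from
    unfolding it. *)
Definition scale : R := locked (2 ^+ 10).

Lemma scaleE : scale = 2 ^+ 10. Proof. by rewrite /scale -lock. Qed.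

Lemma scale_ge16 : 16 <= scale.
Proof.
rewrite scaleE (_ : 16 = 2 ^+ 4 :> R); first by apply: ler_weXn2l; rewrite ?ler1n.
by ring.
Qed.

Lemma scale_gt0 : 0 < scale. Proof. by have := scale_ge16; lra. Qed.

Definition node (n : nat) : R := scale * (mult n)%:R.

Lemma nodeS n : node n.+1 = (growth n)%:R * node n.
Proof. by rewrite /node /= natrM; ring. Qed.

Lemma growth_bounds n : 2 <= ((growth n)%:R : R) <= 3.
Proof. by rewrite /growth; case: ifP; rewrite !ler_nat. Qed.

Lemma node_ge n : scale * 2 ^+ n <= node n.
Proof.
elim: n => [|n IH]; first by rewrite /node /= expr0.
rewrite nodeS exprS; have /andP[r2 r3] := growth_bounds n.
have P0 : 0 < 2 ^+ n :> R by rewrite exprn_gt0.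
rewrite mulrCA; apply: ler_pM => //; apply: mulr_ge0; apply: ltW => //.
exact: scale_gt0.
Qed.

Lemma node_ge_scale n : scale <= node n.
Proof.
apply: le_trans (node_ge n); rewrite ler_peMr ?exprn_ege1 ?ler1n //.
exact: ltW scale_gt0.
Qed.

Lemma node_ge16 n : 16 <= node n.
Proof. exact: le_trans scale_ge16 (node_ge_scale n). Qed.

Lemma node_gt0 n : 0 < node n. Proof. exact: lt_le_trans scale_gt0 (node_ge_scale n). Qed.

Lemma node_leS n : node n.+1 <= 3 * node n.
Proof.
by rewrite nodeS ler_pM2r ?node_gt0 //; case/andP: (growth_bounds n).
Qed.

Lemma node_geS n : 2 * node n <= node n.+1.
Proof.
by rewrite nodeS ler_pM2r ?node_gt0 //; case/andP: (growth_bounds n).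
Qed.

Lemma node_double j k : (j < k)%N -> 2 * node j <= node k.
Proof.
elim: k => // k IH; rewrite ltnS leq_eqVlt => /predU1P[->|/IH H].
  exact: node_geS.
by have := node_geS k; have := node_gt0 k; lra.
Qed.

(** The bump of index n sits where x_(n+2) is expected, and its height is what
    f must return for x_(n+3) = f(x_(n+2)) - a x_n to equal X_(n+3). *)
Definition center n := node n.+2.
Definition shift_coef : R := 108^-1.
Definition height n := node n.+3 + shift_coef * node n.

Lemma center_ge_pow n : 2 ^+ n <= center n.
Proof.
apply: le_trans (node_ge n.+2); rewrite 2!exprS.
have : 0 < 2 ^+ n :> R by rewrite exprn_gt0.
by have := scale_ge16; nra.
Qed.

Lemma height_ge0 n : 0 <= height n.
Proof. by rewrite /height /shift_coef; have := node_gt0 n.+3; have := node_gt0 n; lra. Qed.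

Lemma height_le n : height n <= 4 * center n.
Proof.
rewrite /height /shift_coef /center; have := node_leS n.+2; have := node_geS n; have := node_geS n.+1.
by have := node_gt0 n; lra.
Qed.

(** Nodes at least double at each step, so a gap is at least half the larger
    of its two ends. *)
Lemma center_gap j k : j != k -> Num.max (center j) (center k) <= 2 * `|center j - center k|.
Proof.
wlog jk : j k / (j < k)%N => [H|_].
  rewrite neq_ltn => /orP[jk|kj]; first by apply: H; rewrite ?ltn_eqF.
  by rewrite maxC distrC; apply: H; rewrite ?ltn_eqF.
have H := @node_double j.+2 k.+2 jk; rewrite -/(center j) -/(center k) in H.
have := node_ge16 j.+2; rewrite -/(center j) => Hj.
by rewrite ler0_norm; [rewrite ge_max; apply/andP; split; lra | lra].
Qed.

Lemma expR_decay (t : R) : 0 < t -> expR (- t) <= (4 / t) ^+ 4.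
Proof.
move=> t0; have t4 : 0 < t / 4 by rewrite divr_gt0.
have -> : 4 / t = (t / 4)^-1 by rewrite invf_div.
rewrite exprVn expRN lef_pV2 ?posrE ?expR_gt0 ?exprn_gt0 //.
have := expR_ge1Dx (t / 4); rewrite -[in expR t](divfK (_ : 4 != 0 :> R) t) //.
set u := t / 4 => H; rewrite mulrC expRM_natl ler_pXn2r ?nnegrE ?expR_ge0 //.
  lra.
exact: ltW.
Qed.

End Sequence.

(** * The entire function *)
Section BumpSeries.
Variable R : realType.
Local Notation C := (Cplx R).
Local Notation center := (@center R).
Local Notation node := (@node R).
Local Notation height := (@height R).

Definition weight k : R := height k * expR (- center k ^+ 2).
Definition freq k : C := ofR (2 * center k).
Definition gterm k (z : C) : C := ofR (weight k) * cexp (freq k * z).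
(** The sum of the Gaussian bumps height_k exp (- (z - center_k)^2), see
    [bump_term], with the factor exp (- z^2) taken out: what remains is a series
    of exponentials, for which expansions and periods are immediate. *)
Definition bumps (z : C) : C := cexp (- z ^+ 2) * csum (fun k => gterm k z).

Lemma weight_ge0 k : 0 <= weight k.
Proof. by rewrite mulr_ge0 ?expR_ge0 ?height_ge0. Qed.

Lemma bump_term k (z : C) :
  cexp (- z ^+ 2) * gterm k z = ofR (height k) * cexp (- (z - ofR (center k)) ^+ 2).
Proof.
rewrite /gterm /weight ofRM -cexp_ofR mulrCA -!mulrA -!cexpD; congr (_ * cexp _).
rewrite /freq; move: (center k) => y.
by rewrite ofRM ofRN ofRX (_ : ofR 2 = 2 :> C) ?ofRnat //; ring.
Qed.

Lemma cn_cexp_le (z : C) : cn (cexp z) <= expR (cn z).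
Proof. by rewrite cn_cexp ler_expR; apply: le_trans (ler_norm _) (cre_le z). Qed.

(** Completing the square, - y^2 + 2 y A <= - y^2 / 2 + 2 A^2, and the Gaussian
    beats the powers of y. *)
Lemma weight_decay (A : R) k :
  weight k * center k ^+ 3 * expR (2 * center k * A) <= (4 * 8 ^+ 4) * expR (2 * A ^+ 2) / 2 ^+ k.
Proof.
have y1 : 16 <= center k := @node_ge16 R k.+2; have y0 : 0 < center k by lra.
have y2 : 0 < center k ^+ 2 / 2 by rewrite divr_gt0 // exprn_gt0.
have E : expR (- center k ^+ 2) * expR (2 * center k * A) <=
    (8 / center k ^+ 2) ^+ 4 * expR (2 * A ^+ 2).
  have D := expR_decay y2.
  rewrite (_ : 4 / (center k ^+ 2 / 2) = 8 / center k ^+ 2) in D; last first.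
    by field; rewrite gt_eqF.
  apply: le_trans (ler_wpM2r (expR_ge0 _) D).
  rewrite -!expRD ler_expR -subr_ge0.
  rewrite (_ : _ - _ = 2^-1 * (center k - 2 * A) ^+ 2); last by field.
  by rewrite mulr_ge0 // sqr_ge0.
rewrite /weight.
have -> : height k * expR (- center k ^+ 2) * center k ^+ 3 * expR (2 * center k * A) =
  height k * center k ^+ 3 * (expR (- center k ^+ 2) * expR (2 * center k * A)) by ring.
apply: (@le_trans _ _ (4 * center k * center k ^+ 3 *
    ((8 / center k ^+ 2) ^+ 4 * expR (2 * A ^+ 2)))).
  have Y3 : 0 <= center k ^+ 3 by rewrite exprn_ge0 // ltW.
  apply: ler_pM E.
  - exact: mulr_ge0 (height_ge0 _ _) Y3.
  - by rewrite mulr_ge0 ?expR_ge0.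
  - by rewrite ler_wpM2r // height_le.
have -> : 4 * center k * center k ^+ 3 * ((8 / center k ^+ 2) ^+ 4 * expR (2 * A ^+ 2)) =
    (4 * 8 ^+ 4) * expR (2 * A ^+ 2) / center k ^+ 4 by field; rewrite gt_eqF.
rewrite ler_wpM2l ?mulr_ge0 ?expR_ge0 // lef_pV2 ?posrE ?exprn_gt0 //.
apply: le_trans (center_ge_pow R k) _.
by rewrite -[leLHS]expr1; apply: ler_weXn2l => //; lra.
Qed.

Lemma cn_gterm k (z : C) (A : R) : cn z <= A ->
  cn (gterm k z) <= weight k * expR (2 * center k * A).
Proof.
move=> zA; have y1 : 16 <= center k := @node_ge16 R k.+2.
apply: cn_bound_mul; first by rewrite cn_ofR ger0_norm // weight_ge0.
apply: le_trans (cn_cexp_le _) _; rewrite ler_expR cnM cn_ofR ger0_norm; last lra.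
by rewrite ler_pM2l //; lra.
Qed.

Lemma gterm_dominated (j : nat) (z : C) (A : R) : (j <= 3)%N -> cn z <= A ->
  dominated (fun k => gterm k z * freq k ^+ j)
    (8 * ((4 * 8 ^+ 4) * expR (2 * A ^+ 2))).
Proof.
move=> j3 zA k; have y1 : 16 <= center k := @node_ge16 R k.+2.
apply: (@le_trans _ _ (8 * (weight k * center k ^+ 3 * expR (2 * center k * A)))).
  rewrite cnM cnX cn_ofR ger0_norm; last lra.
  have : (2 * center k) ^+ j <= (2 * center k) ^+ 3 by apply: ler_weXn2l => //; lra.
  have := cn_gterm k zA; have := cn_ge0 (gterm k z).
  have P : 0 <= (2 * center k) ^+ j by rewrite exprn_ge0 //; lra.
  move=> g0 g1 e1; apply: le_trans (ler_pM _ _ g1 e1) _ => //.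
  by rewrite le_eqVlt; apply/orP; left; apply/eqP; ring.
by rewrite -[leRHS]mulrA ler_pM2l // weight_decay.
Qed.

(** Each exponential is expanded to order 2; the coefficients and the cubic
    remainder are dominated uniformly for |h| < 1, so that the expansions can be
    summed. *)
Lemma gsum_jet (z : C) : jet_at 3 (fun z => csum (fun k => gterm k z)) z.
Proof.
pose A : R := cn z + 1.
have zA : cn z <= A by rewrite /A; lra.
pose B := 8 * ((4 * 8 ^+ 4) * expR (2 * A ^+ 2)) : R.
have dj j : (j <= 3)%N -> dominated (fun k => gterm k z * freq k ^+ j) B.
  by move=> j3; exact: gterm_dominated.
pose u j k := gterm k z * freq k ^+ j.
pose e h := csum (fun k => u 3%N k * cexp_tail (freq k * h)).
have De h : cn h < 1 -> dominated (fun k => u 3%N k * cexp_tail (freq k * h)) (16 * B).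
  move=> h1 k; have y1 : 16 <= center k := @node_ge16 R k.+2.
  have w0 := weight_ge0 k.
  apply: (@le_trans _ _ (16 * (8 * (weight k * center k ^+ 3 * expR (2 * center k * A))))).
    rewrite /u cnM [cn (gterm k z * _)]cnM cnX cn_ofR ger0_norm; last lra.
    have T := cn_cexp_tail (freq k * h).
    rewrite cnM cn_ofR ger0_norm in T; last lra.
    have G := cn_gterm k (lexx (cn z)).
    have E : expR (2 * center k * cn z) * expR (2 * center k * cn h) <= expR (2 * center k * A).
      by rewrite -expRD ler_expR -mulrDr ler_pM2l /A; lra.
    have P : 0 <= (2 * center k) ^+ 3 by rewrite exprn_ge0 //; lra.
    apply: (@le_trans _ _ (weight k * expR (2 * center k * cn z) * (2 * center k) ^+ 3 *
        (16 * expR (2 * center k * cn h)))).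
      apply: ler_pM T; rewrite ?cn_ge0 //; last exact: ler_wpM2r P _ _ G.
      by apply: mulr_ge0 P; exact: cn_ge0.
    have -> : weight k * expR (2 * center k * cn z) * (2 * center k) ^+ 3 *
        (16 * expR (2 * center k * cn h)) =
      16 * (8 * (weight k * center k ^+ 3)) *
        (expR (2 * center k * cn z) * expR (2 * center k * cn h)) by ring.
    have -> : 16 * (8 * (weight k * center k ^+ 3 * expR (2 * center k * A))) =
      16 * (8 * (weight k * center k ^+ 3)) * expR (2 * center k * A) by ring.
    have Y3 : 0 <= center k ^+ 3 by rewrite exprn_ge0 //; lra.
    by apply: ler_wpM2l E; apply: mulr_ge0 => //; apply: mulr_ge0 => //; exact: mulr_ge0 w0 Y3.
  rewrite -[leRHS]mulrA ler_pM2l // -[leRHS]mulrA ler_pM2l //.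
  exact: weight_decay.
have expand h : cn h < 1 -> csum (fun k => gterm k (z + h)) =
   csum (u 0%N) + h * (csum (u 1%N) + h * (2^-1 * csum (u 2%N) + h * e h)).
  move=> h1; have D0 : dominated (u 0%N) B := dj 0%N isT.
  have D1 : dominated (u 1%N) B := dj 1%N isT.
  have D2 : dominated (u 2%N) B := dj 2%N isT.
  have D3 := De h h1.
  have dZ (c : C) (v : nat -> C) b : dominated v b -> dominated (fun k => c * v k) (cn c * b).
    by move=> vb k; rewrite cnM -mulrA ler_wpM2l ?cn_ge0.
  have dD (v v' : nat -> C) b b' : dominated v b -> dominated v' b' ->
      dominated (fun k => v k + v' k) (b + b').
    by move=> vb vb' k; rewrite mulrDl; exact: cn_bound_add.
  rewrite /e -(csumZ h D3) -(csumZ 2^-1 D2) -(csumD (dZ _ _ _ D2) (dZ _ _ _ D3)).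
  rewrite -(csumZ h (dD _ _ _ _ (dZ _ _ _ D2) (dZ _ _ _ D3))).
  have D4 := dZ h _ _ (dD _ _ _ _ (dZ 2^-1 _ _ D2) (dZ h _ _ D3)).
  rewrite -(csumD D1 D4) -(csumZ h (dD _ _ _ _ D1 D4)).
  rewrite -(csumD D0 (dZ h _ _ (dD _ _ _ _ D1 D4))).
  congr csum; apply/funext => k; rewrite /u /gterm mulrDr cexpD.
  by rewrite (cexp_taylor (freq k * h)); field.
exists (csum (u 0%N)), (fun h => csum (u 1%N) + h * (2^-1 * csum (u 2%N) + h * e h)), 1.
split=> //; exists (csum (u 1%N)), (fun h => 2^-1 * csum (u 2%N) + h * e h), 1.
split=> //; exists (2^-1 * csum (u 2%N)), e, 1.
split=> //; exists (4 * (16 * B)), 1; split=> // h h1.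
exact/csum_bound/De.
Qed.

Lemma cexp_jet (z : C) : jet_at 3 (@cexp R) z.
Proof.
pose T h := cexp z * cexp_tail h.
exists (cexp z), (fun h => cexp z + h * (cexp z / 2 + h * T h)), 1.
split=> // [h _|]; first by rewrite cexpD (cexp_taylor h) /T; field.
exists (cexp z), (fun h => cexp z / 2 + h * T h), 1; split=> //.
exists (cexp z / 2), T, 1; split=> //.
exists (cn (cexp z) * (16 * expR 1)), 1; split=> // h h1.
apply: cn_bound_mul => //; apply: le_trans (cn_cexp_tail h) _.
by rewrite ler_pM2l // ler_expR ltW.
Qed.

Lemma bumps_jet (z : C) : jet_at 3 bumps z.
Proof.
apply: jetM; last exact: gsum_jet.
have := @jet_at_comp R 2 (@cexp R) (fun z => - z ^+ 2) z (cexp_jet _); apply.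
apply: (@jetN _ _ (fun h => (z + h) ^+ 2)).
apply: (@jetX _ _ (fun h => z + h)); exact: (jet_at_id 3 z).
Qed.

End BumpSeries.

(** * Orbits shadowing the nodes *)
Section ShadowOrbit.
Variable R : realType.
Local Notation C := (Cplx R).
Local Notation center := (@center R).
Local Notation node := (@node R).
Local Notation height := (@height R).
Local Notation shift_coef := (shift_coef R).

(** Near its centre a bump of height c errs by at most 10 c |h|^2.  With
    |h| <= tolerance / X and c <= 4 X, this is a small part of tolerance / X
    as soon as the tolerance is a small enough constant. *)
Definition tolerance : R := locked 480^-1.

Lemma toleranceE : 480 * tolerance = 1. Proof. by rewrite /tolerance -lock; field. Qed.
Lemma tolerance_gt0 : 0 < tolerance. Proof. by have := toleranceE; lra. Qed.

Lemma cexp_near1 (w : C) : cn w <= 2^-1 -> cn (cexp w - 1) <= 10 * cn w.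
Proof.
move=> w2; have -> : cexp w - 1 = w * (1 + w * (2^-1 + w * cexp_tail w)).
  by rewrite (cexp_taylor w); field.
have e2 : expR (cn w) <= 2.
  have := expR_ge1Dx (- cn w); have := expRxMexpNx_1 (cn w); have := expR_gt0 (cn w).
  by move: (expR (cn w)) (expR (- cn w)) => p q; nra.
have T : cn (cexp_tail w) <= 32 by apply: le_trans (cn_cexp_tail w) _; lra.
have h2 : cn (2^-1 : C) <= 2^-1 by rewrite cnV cn_nat.
rewrite mulrC [leRHS]mulrC mulrC [leRHS]mulrC.
have := cn_bound_mul (lexx (cn w)) (cn_bound_add (lexx (cn (1 : C)))
  (cn_bound_mul w2 (cn_bound_add h2 (cn_bound_mul w2 T)))).
rewrite cn1 mulrC => H; apply: le_trans H _.
by have := cn_ge0 w; lra.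
Qed.

(** The real part of the square of the distance is at least of the order of
    the square of the larger of the two centres, so the k-th bump is small
    against any power of both: one factor pays for the sum over k, six others
    for the accuracy at centre m. *)
Lemma bump_far k m (h : C) : k != m -> cn h <= 1 ->
  cn (ofR (height k) * cexp (- (ofR (center m) + h - ofR (center k)) ^+ 2)) <=
  (4 * 64 ^+ 4 / center m ^+ 6) / 2 ^+ k.
Proof.
move=> km h1; have G := @center_gap R _ _ km; have G1 := @node_ge16 R m.+2.
have c0 := @height_ge0 R k; have c4 := @height_le R k.
have P := @center_ge_pow R k; rewrite -/(center m) in G1.
set M := Num.max (center k) (center m) in G.
have [Mk Mm] : center k <= M /\ center m <= M by rewrite /M !le_max !lexx orbT.
set w := ofR (center m) + h - ofR (center k).
have yk0 : 0 < center k by apply: node_gt0.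
have M0 : 0 < M by apply: lt_le_trans yk0 Mk.
have E : cn (cexp (- w ^+ 2)) <= (64 / M ^+ 2) ^+ 4.
  have t0 : 0 < M ^+ 2 / 16 by rewrite divr_gt0 // exprn_gt0.
  have := expR_decay t0.
  rewrite (_ : 4 / (M ^+ 2 / 16) = 64 / M ^+ 2); last by field; rewrite gt_eqF.
  apply: le_trans; rewrite cn_cexp ler_expR creN expr2 creM.
  have r : cre w = center m - center k + cre h.
    by rewrite /w !creD creN !cre_ofR; ring.
  have i : cim w = cim h by rewrite /w !cimD cimN !cim_ofR; ring.
  have := cre_le h; have := cim_le h; rewrite i r !ler_norml.
  move=> /andP[i1 i2] /andP[r1 r2].
  have M16 : 16 <= M by apply: le_trans Mm.
  have [D|D] := leP 0 (center k - center m).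
    by rewrite ger0_norm // in G; nra.
  by rewrite ltr0_norm // in G; nra.
apply: (@le_trans _ _ (4 * M * (64 / M ^+ 2) ^+ 4)).
  by apply: cn_bound_mul E; rewrite cn_ofR ger0_norm //; lra.
have -> : 4 * M * (64 / M ^+ 2) ^+ 4 = 4 * 64 ^+ 4 / (M ^+ 6 * M).
  by field; rewrite gt_eqF.
rewrite -[leRHS]mulrA ler_wpM2l ?mulr_ge0 ?exprn_ge0 // -invfM lef_pV2 ?posrE.
- apply: ler_pM; rewrite ?exprn_ge0 //; try lra.
  by rewrite ler_pXn2r ?nnegrE //; lra.
- by rewrite mulr_gt0 ?exprn_gt0.
- by rewrite mulr_gt0 ?exprn_gt0 //; lra.
Qed.

Lemma bumps_split m (h : C) : cn h <= 1 ->
  cn (bumps (ofR (center m) + h) - ofR (height m) * cexp (- h ^+ 2)) <=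
  4 * (4 * 64 ^+ 4 / center m ^+ 6).
Proof.
move=> h1; set z := ofR (center m) + h.
have D0 : dominated (fun k => gterm k z) (8 * ((4 * 8 ^+ 4) * expR (2 * cn z ^+ 2))).
  have := @gterm_dominated R 0 z (cn z) isT (lexx _).
  by under eq_fun do rewrite expr0 mulr1.
rewrite /bumps -(csumZ (cexp (- z ^+ 2)) D0).
pose u k := ofR (height k) * cexp (- (z - ofR (center k)) ^+ 2).
have -> : (fun k => cexp (- z ^+ 2) * gterm k z) =
   (fun k => (if k == m then u m else 0) + (if k == m then 0 else u k)).
  apply/funext => k; rewrite bump_term -/(u k).
  by have [->|_] := eqVneq k m; rewrite ?addr0 ?add0r.
have D1 : dominated (fun k => if k == m then u m else 0) (cn (u m) * 2 ^+ m).
  move=> k; have [->|_] := eqVneq k m; first by rewrite mulfK // expf_neq0.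
  by rewrite cn0 !mulr_ge0 ?cn_ge0 ?invr_ge0 ?exprn_ge0.
have D2 : dominated (fun k => if k == m then 0 else u k) (4 * 64 ^+ 4 / center m ^+ 6).
  move=> k; have [_|km] := eqVneq k m; last exact: bump_far.
  by rewrite cn0 !mulr_ge0 ?invr_ge0 ?exprn_ge0 // ltW // node_gt0.
rewrite (csumD D1 D2) csum_single.
have -> : u m = ofR (height m) * cexp (- h ^+ 2).
  by rewrite /u /z addrAC subrr add0r.
by rewrite addrAC subrr add0r; exact: csum_bound.
Qed.

(** Three quarters of the tolerance at the next node are used; the last quarter
    is left for the term a x_n of the recurrence. *)
Lemma bumps_near m (h : C) : cn h <= tolerance / center m ->
  cn (bumps (ofR (center m) + h) - ofR (height m)) <= 3 / 4 * (tolerance / node m.+3).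
Proof.
move=> hk; have k0 := tolerance_gt0; have kE := toleranceE.
have y16 : 16 <= center m := @node_ge16 R m.+2; have y0 : 0 < center m by lra.
have i0 : 0 < (center m)^-1 by rewrite invr_gt0.
have i1 : (center m)^-1 <= 16^-1 by rewrite lef_pV2 ?posrE.
have kY : tolerance / center m <= 2^-1 by nra.
have k00 : 0 <= tolerance / center m by rewrite mulr_ge0 // ltW.
have h2 : cn (- h ^+ 2) <= (tolerance / center m) ^+ 2.
  by rewrite cnN cnX ler_pXn2r ?nnegrE ?cn_ge0.
have h2' : cn (- h ^+ 2) <= 2^-1 by apply: le_trans h2 _; nra.
have h1 : cn h <= 1 by lra.
have S := bumps_split m h1; have N := cexp_near1 h2'.
have -> : bumps (ofR (center m) + h) - ofR (height m) =
  (bumps (ofR (center m) + h) - ofR (height m) * cexp (- h ^+ 2)) +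
  ofR (height m) * (cexp (- h ^+ 2) - 1) by ring.
have c4 : cn (ofR (height m) : C) <= 4 * center m.
  by rewrite cn_ofR ger0_norm ?height_ge0 // height_le.
have N' : cn (cexp (- h ^+ 2) - 1) <= 10 * (tolerance / center m) ^+ 2.
  by apply: le_trans N _; rewrite ler_pM2l.
apply: le_trans (cn_bound_add S (cn_bound_mul c4 N')) _.
have X3 : node m.+3 <= 3 * center m := node_leS R m.+2.
have KX : tolerance / (3 * center m) <= tolerance / node m.+3.
  by rewrite ler_pM2l // lef_pV2 ?posrE ?node_gt0 // mulr_gt0.
have E1 : 4 * center m * (10 * (tolerance / center m) ^+ 2) = 40 * tolerance * (tolerance / center m).
  by field; rewrite gt_eqF.
have E3 : tolerance / (3 * center m) = 3^-1 * (tolerance / center m) by field; rewrite gt_eqF.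
have Y5 : (2 ^+ 10) ^+ 5 <= center m ^+ 5.
  rewrite ler_pXn2r ?nnegrE ?exprn_ge0 ?(ltW y0) // -scaleE.
  exact: node_ge_scale.
have E2 : 4 * (4 * 64 ^+ 4 / center m ^+ 6) <= 6^-1 * (tolerance / center m).
  have -> : 4 * (4 * 64 ^+ 4 / center m ^+ 6) = (16 * 64 ^+ 4 / center m ^+ 5) / center m.
    by field; rewrite gt_eqF.
  have -> : 6^-1 * (tolerance / center m) = 6^-1 * tolerance / center m by ring.
  rewrite (ler_pM2r i0) ler_pdivrMr ?exprn_gt0 //.
  have : 2 ^+ 50 <= center m ^+ 5 by rewrite (_ : 50 = 10 * 5)%N // exprM.
  have -> : tolerance = 480^-1 by lra.
  have p : (0 : R) < 2 ^+ 28 by rewrite exprn_gt0.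
  have -> : 16 * 64 ^+ 4 = 2 ^+ 28 :> R by ring.
  have -> : 2 ^+ 50 = 4 * 1024 * 1024 * 2 ^+ 28 :> R by ring.
  by lra.
rewrite E1; nra.
Qed.

Lemma shadow_orbit (x : nat -> C) :
  (forall n, x n.+3 = bumps (x n.+2) - ofR shift_coef * x n) ->
  (forall i, (i < 3)%N -> cn (x i - ofR (node i)) <= tolerance / node i) ->
  forall n, cn (x n - ofR (node n)) <= tolerance / node n.
Proof.
move=> xS x3; elim/ltn_ind => -[|[|[|n]]] IH; try exact: x3.
have H0 := IH n (leq_trans (ltnSn n) (leqW (leqnSn _))).
have H2 := IH n.+2 (ltnSn _).
have := @bumps_near n (x n.+2 - ofR (node n.+2)) H2.
rewrite [ofR (center n) + _]addrC subrK => N.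
have -> : x n.+3 - ofR (node n.+3) = (bumps (x n.+2) - ofR (height n)) -
    ofR shift_coef * (x n - ofR (node n)).
  by rewrite xS /height ofRD ofRM; ring.
have a00 : 0 <= shift_coef by rewrite /shift_coef invr_ge0.
apply: le_trans (cnB _ _) _; rewrite cnM [cn (ofR shift_coef)]cn_ofR ger0_norm //.
have k0 := tolerance_gt0.
have X27 : node n.+3 <= 27 * node n.
  by have := node_leS R n; have := node_leS R n.+1; have := node_leS R n.+2; lra.
have : tolerance / node n <= 27 * (tolerance / node n.+3).
  rewrite mulrCA ler_pM2l // -[leRHS]invrK lef_pV2 ?posrE ?invr_gt0 ?node_gt0 //.
    by rewrite invfM invrK ler_pdivrMl.
  by rewrite mulr_gt0 ?invr_gt0 ?node_gt0.
have : shift_coef * cn (x n - ofR (node n)) <= shift_coef * (tolerance / node n) by rewrite ler_wpM2l.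
have : 108 * shift_coef = 1 by rewrite /shift_coef; field.
by nra.
Qed.

End ShadowOrbit.

(** * The function is entire and not a polynomial *)
Section Transcendence.
Variable R : realType.
Local Notation C := (Cplx R).

Lemma jet_derivable (f : C -> C) z : jet_at 2 f z -> derivable f z 1.
Proof.
move=> [c0 [e [d [d0 fe [c1 [e' [d' [d'0 ee [M [r [r0 eM]]]]]]]]]]].
have c0E : c0 = f z by rewrite -[in RHS](addr0 z) fe ?cn0 // mul0r addr0.
apply/cvg_ex; exists c1; apply/cvgrPdist_le => eps /posC_ofR[q q0 ->].
have M0 : 0 <= M by apply: le_trans (eM 0 _); rewrite ?cn_ge0 ?cn0.
pose t := Num.min (Num.min d d') (Num.min r (q / (M + 1))).
have t0 : 0 < t by rewrite !lt_min d0 d'0 r0 divr_gt0 // ltr_wpDl.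
exists (ofR t) => /=; first by rewrite -ofR0 ofR_lt.
move=> h /=; rewrite sub0r normE ofR_lt cnN !lt_min ltr_pdivlMr ?ltr_wpDl //.
move=> /andP[/andP[h1 h2] /andP[h3 h4]] h0.
rewrite normE ofR_le -!/(_ * _) [h *: 1]mulr1 [h + z]addrC fe // c0E addrAC subrr add0r.
rewrite ee // [_ *: _]mulKf // opprD addrA subrr add0r cnN.
have := cn_bound_mul (lexx (cn h)) (eM h h3).
have : cn h * (M + 1) = cn h * M + cn h by ring.
have := cn_ge0 h; lra.
Qed.

Lemma bumps_entire : entire (@bumps R).
Proof. by move=> z; apply: jet_derivable; apply: jet_leq (bumps_jet z). Qed.

Lemma cos_sin_2pin n : cos (2 * n%:R * pi) = 1 :> R /\ sin (2 * n%:R * pi) = 0 :> R.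
Proof.
elim: n => [|n [IHc IHs]]; first by rewrite mulr0 mul0r cos0 sin0.
have -> : 2 * n.+1%:R * pi = 2 * n%:R * pi + pi *+ 2 :> R by rewrite -natr1; ring.
by rewrite cosD2pi sinD2pi.
Qed.

Let tau : C := iofR (pi / scale R).

(** Adding i pi / scale to z multiplies exp (2 center_k z) by a power of
    exp (2 i pi). *)
Lemma bumps_quasiperiodic z :
  bumps (z + tau) = cexp (- (2 * z * tau + tau ^+ 2)) * bumps z.
Proof.
rewrite /bumps mulrA -cexpD; congr (cexp _ * csum _); first by ring.
apply/funext => k; rewrite /gterm mulrDr cexpD.
suff -> : cexp (freq R k * tau) = 1 by rewrite mulr1.
have [c s] := cos_sin_2pin (mult k.+2).
have S0n : scale R != 0 by rewrite gt_eqF // scale_gt0.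
rewrite /cexp creM cimM cre_ofR cim_ofR cre_iofR cim_iofR mulr0 mul0r subr0 mul0r addr0.
have -> : 2 * center R k * (pi / scale R) = 2 * (mult k.+2)%:R * pi.
  by rewrite /center /node; field.
by rewrite expR0 c s mulr1 mulr0.
Qed.

Lemma tau_neq0 : tau != 0.
Proof. by rewrite -cn_gt0 cn_iofR normr_gt0 gt_eqF // divr_gt0 ?pi_gt0 ?scale_gt0. Qed.

Lemma bumps_center0_neq0 : bumps (ofR (center R 0)) != 0.
Proof.
have := @bumps_near R 0 0; rewrite cn0 addr0 => /(_ _).
have k0 := tolerance_gt0 R; have kE := toleranceE R.
rewrite mulr_ge0 ?invr_ge0 ?(ltW (node_gt0 _ _)) ?(ltW k0) // => /(_ isT) H.
apply/eqP => E; rewrite E sub0r cnN cn_ofR ger0_norm ?height_ge0 // in H.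
have i1 : (node R 3)^-1 <= 16^-1 by rewrite lef_pV2 ?posrE ?node_gt0 // node_ge16.
have i0 : 0 < (node R 3)^-1 by rewrite invr_gt0 node_gt0.
have := node_ge16 R 3; have := node_ge16 R 0; move: H; rewrite /height /shift_coef.
have : tolerance R * (node R 3)^-1 <= 1 by nra.
lra.
Qed.

(** The zeros of f are invariant under translation by tau: a nonconstant
    polynomial would have infinitely many of them.  A nonzero constant is
    excluded by |f(tau)| = exp ((pi / scale)^2) |f(0)|. *)
Lemma bumps_transcendental : transcendental_entire (@bumps R).
Proof.
split; first exact: bumps_entire.
move=> [p pE].
have p0 : p != 0.
  by apply/eqP => p0; have := bumps_center0_neq0; rewrite pE p0 horner0 eqxx.
have [sp|sp] := eqVneq (size p) 1%N.
  have [c c0 pc] : exists2 c, c != 0 & p = c%:P by apply/size_poly1P; rewrite sp.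
  have := bumps_quasiperiodic 0; rewrite !pE pc !hornerC mulr0 mul0r !add0r.
  move=> /(congr1 (fun x => x / c)); rewrite mulfV // mulfK // => /(congr1 (@cn R)).
  rewrite cn1 cn_cexp creN expr2 creM cre_iofR cim_iofR mulr0 sub0r opprK => E.
  have t0 : 0 < pi / scale R by rewrite divr_gt0 ?pi_gt0 ?scale_gt0.
  have := @expR_gt1 R (pi / scale R * (pi / scale R)).
  by rewrite -E ltxx mulr_gt0.
have /closed_rootP[z0 rz0] := sp.
have rn n : root p (z0 + n%:R * tau).
  elim: n => [|n IH]; first by rewrite mul0r addr0.
  rewrite -natr1 mulrDl mul1r addrA /root -pE bumps_quasiperiodic pE.
  by rewrite (rootP IH) mulr0.
have := @max_poly_roots _ p [seq z0 + n%:R * tau | n <- iota 0 (size p)] p0.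
rewrite size_map size_iota ltnn => H; suff : false by []; apply: H.
  by apply/allP => x /mapP[n _ ->]; exact: rn.
rewrite map_inj_uniq ?iota_uniq // => i j /addrI /(mulIf tau_neq0) /eqP.
by rewrite eqr_nat => /eqP.
Qed.

End Transcendence.

(** * The chordal metric *)
Section Projective.
Variable R : realType.
Local Notation C := (Cplx R).

Section AnyDimension.
Variable n : nat.
Implicit Types (v w : 'rV[C]_n.+1) (p q : Defs.proj R n).

Definition sqnorm v : R := \sum_j cn (v 0 j) ^+ 2.
(** The squared length of the exterior product, in homogeneous coordinates. *)
Definition wedge2 v w : R :=
  \sum_(i < n.+1) \sum_(j < n.+1 | (i < j)%N) cn (v 0 i * w 0 j - v 0 j * w 0 i) ^+ 2.

Lemma hcoord_neq0 p : hcoord p != 0.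
Proof.
rewrite /hcoord vpick0 -dimv_eq0; case: p => L /= /eqP ->.
by [].
Qed.

Lemma hcoord_pt v (v0 : v != 0) : exists2 c, c != 0 & hcoord (proj_pt v0) = c *: v.
Proof.
have /vlineP[c cE] : hcoord (proj_pt v0) \in <[v]>%VS by apply: memv_pick.
exists c => //; apply: contra (hcoord_neq0 (proj_pt v0)) => /eqP c0.
by rewrite cE c0 scale0r.
Qed.

Lemma sqnormZ c v : sqnorm (c *: v) = cn c ^+ 2 * sqnorm v.
Proof.
rewrite /sqnorm mulr_sumr; apply: eq_bigr => j _.
by rewrite mxE cnM exprMn.
Qed.

Lemma wedge2Z a b v w :
  wedge2 (a *: v) (b *: w) = cn a ^+ 2 * cn b ^+ 2 * wedge2 v w.
Proof.
rewrite /wedge2 mulr_sumr; apply: eq_bigr => i _.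
rewrite mulr_sumr; apply: eq_bigr => j _.
rewrite !mxE (_ : _ - _ = (a * b) * (v 0 i * w 0 j - v 0 j * w 0 i)); last by ring.
by rewrite !cnM !exprMn.
Qed.

Lemma sqnorm_ge j v : cn (v 0 j) ^+ 2 <= sqnorm v.
Proof.
rewrite /sqnorm (bigD1 j) //= lerDl sumr_ge0 // => i _.
by rewrite exprn_ge0 // cn_ge0.
Qed.

Lemma sqnorm_gt0 v : v != 0 -> 0 < sqnorm v.
Proof.
move=> v0; have [j vj] : exists j, v 0 j != 0.
  apply: contrapT => H; case/negP: v0; apply/eqP/rowP => j; rewrite mxE.
  by apply/eqP; apply: contrapT => /negP vj; apply: H; exists j.
by apply: lt_le_trans (sqnorm_ge j v); rewrite exprn_gt0 // cn_gt0.
Qed.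

Lemma ofR_sum (I : Type) (r : seq I) (P : pred I) (F : I -> R) :
  ofR (\sum_(i <- r | P i) F i) = \sum_(i <- r | P i) ofR (F i) :> C.
Proof. by apply: (big_morph (@ofR R)) => [x y|]; rewrite ?ofRD ?ofR0. Qed.

Lemma wedge2_ge0 v w : 0 <= wedge2 v w.
Proof.
by rewrite /wedge2; do 2!apply: sumr_ge0 => ? _; rewrite exprn_ge0 // cn_ge0.
Qed.

Lemma proj_dist_lt p q (e : R) : 0 < e ->
  (proj_dist p q < ofR e) =
  (wedge2 (hcoord p) (hcoord q) < e ^+ 2 * (sqnorm (hcoord p) * sqnorm (hcoord q))).
Proof.
move=> e0; rewrite /proj_dist /hermitian_norm /=.
set v := hcoord p; set w := hcoord q.
have -> : \sum_(i < n.+1) \sum_(j < n.+1 | (i < j)%N)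
    `|v 0 i * w 0 j - v 0 j * w 0 i| ^+ 2 = ofR (wedge2 v w).
  rewrite /wedge2 ofR_sum; apply: eq_bigr => i _; rewrite ofR_sum.
  by apply: eq_bigr => j _; rewrite normE ofRX.
have sq (u : 'rV[C]_n.+1) : \sum_j `|u 0 j| ^+ 2 = ofR (sqnorm u).
  by rewrite /sqnorm ofR_sum; apply: eq_bigr => j _; rewrite normE ofRX.
rewrite !sq.
have v0 : 0 < ofR (sqnorm v) by rewrite -ofR0 ofR_lt sqnorm_gt0 // hcoord_neq0.
have w0 : 0 < ofR (sqnorm w) by rewrite -ofR0 ofR_lt sqnorm_gt0 // hcoord_neq0.
have a0 : 0 <= ofR (wedge2 v w) by rewrite -ofR0 ofR_le wedge2_ge0.
have e0' : 0 <= ofR e by rewrite -ofR0 ofR_le ltW.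
rewrite ltr_pdivrMr ?mulr_gt0 ?sqrtC_gt0 //.
rewrite -(@ltr_pXn2r _ 2) ?nnegrE ?sqrtC_ge0 ?mulr_ge0 ?sqrtC_ge0 ?(ltW v0) ?(ltW w0) //.
by rewrite !exprMn !sqrtCK -ofRX -!ofRM ofR_lt.
Qed.

Lemma proj_dist_pt_lt v w (v0 : v != 0) (w0 : w != 0) (e : R) : 0 < e ->
  (proj_dist (proj_pt v0) (proj_pt w0) < ofR e) =
  (wedge2 v w < e ^+ 2 * (sqnorm v * sqnorm w)).
Proof.
move=> e0; rewrite proj_dist_lt //.
have [c c0 ->] := hcoord_pt v0; have [d d0 ->] := hcoord_pt w0.
rewrite wedge2Z !sqnormZ.
rewrite (_ : e ^+ 2 * _ = cn c ^+ 2 * cn d ^+ 2 * (e ^+ 2 * (sqnorm v * sqnorm w))).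
  by rewrite ltr_pM2l // mulr_gt0 ?exprn_gt0 ?cn_gt0.
by ring.
Qed.

(** A real function on projective space, Lipschitz for the chordal distance
    ([share_lip]), through which iterates are compared: a lower bound on it
    says that the other coordinates are bounded by a multiple of this one. *)
Definition share (i : 'I_n.+1) p : R := cn (hcoord p 0 i) ^+ 2 / sqnorm (hcoord p).

Lemma share_pt i v (v0 : v != 0) : share i (proj_pt v0) = cn (v 0 i) ^+ 2 / sqnorm v.
Proof.
rewrite /share; have [c c0 ->] := hcoord_pt v0.
rewrite sqnormZ mxE cnM exprMn; field.
by rewrite cn_eq0 c0 gt_eqF // sqnorm_gt0.
Qed.

Lemma wedge2_ge i j v w : cn (v 0 i * w 0 j - v 0 j * w 0 i) ^+ 2 <= wedge2 v w.
Proof.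
have main (k l : 'I_n.+1) : (k < l)%N -> cn (v 0 k * w 0 l - v 0 l * w 0 k) ^+ 2 <= wedge2 v w.
  move=> kl; rewrite /wedge2 (bigD1 k) //= (bigD1 l) //= -addrA lerDl.
  rewrite addr_ge0 // sumr_ge0 // => ? _; rewrite ?sumr_ge0 // => *;
  by rewrite exprn_ge0 // cn_ge0.
have [ij|ji|/val_inj ->] := ltngtP i j.
- exact: main.
- by rewrite cnBC main.
- by rewrite subrr cn0 expr0n wedge2_ge0.
Qed.

(** Over a common denominator, the difference of shares is a sum of terms
    |v_i w_j|^2 - |v_j w_i|^2, each controlled by the wedge coordinate
    v_i w_j - v_j w_i. *)
Lemma share_lip i p q (e : R) : 0 < e -> proj_dist p q < ofR e ->
  `|share i p - share i q| <= (n.+1)%:R * (2 * e).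
Proof.
move=> e0; rewrite proj_dist_lt // /share.
have := sqnorm_gt0 (hcoord_neq0 p); have := sqnorm_gt0 (hcoord_neq0 q).
move: (hcoord p) (hcoord q) => v w w0 v0 vw.
have -> : cn (v 0 i) ^+ 2 / sqnorm v - cn (w 0 i) ^+ 2 / sqnorm w =
  (cn (v 0 i) ^+ 2 * sqnorm w - cn (w 0 i) ^+ 2 * sqnorm v) / (sqnorm v * sqnorm w).
  by field; rewrite !gt_eqF.
have T0 : 0 < sqnorm v * sqnorm w by rewrite mulr_gt0.
rewrite normrM normfV (gtr0_norm T0) ler_pdivrMr //.
have -> : cn (v 0 i) ^+ 2 * sqnorm w - cn (w 0 i) ^+ 2 * sqnorm v =
    \sum_j (cn (v 0 i) ^+ 2 * cn (w 0 j) ^+ 2 - cn (w 0 i) ^+ 2 * cn (v 0 j) ^+ 2).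
  by rewrite /sqnorm !mulr_sumr -sumrB.
apply: le_trans (ler_norm_sum _ _ _) _.
pose K := 2 * e * (sqnorm v * sqnorm w).
apply: (@le_trans _ _ (\sum_(j < n.+1) K)); last first.
  by rewrite sumr_const card_ord -[K *+ _]mulr_natl /K !mulrA.
apply: ler_sum => j _; rewrite /K.
rewrite -!exprMn -!cnM.
set x := v 0 i * w 0 j; rewrite [w 0 i * _]mulrC; set y := v 0 j * w 0 i.
have D : cn (x - y) ^+ 2 <= e ^+ 2 * (sqnorm v * sqnorm w).
  by apply: le_trans (ltW vw); exact: wedge2_ge.
have Bx : cn x ^+ 2 <= sqnorm v * sqnorm w.
  by rewrite cnM exprMn ler_pM ?exprn_ge0 ?cn_ge0 ?sqnorm_ge.
have By : cn y ^+ 2 <= sqnorm v * sqnorm w.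
  by rewrite cnM exprMn ler_pM ?exprn_ge0 ?cn_ge0 ?sqnorm_ge.
move: D Bx By (cn_dist x y) T0 (cn_ge0 x) (cn_ge0 y) (cn_ge0 (x - y)).
set T := sqnorm v * sqnorm w => D Bx By dxy T0 x0 y0 d0.
pose t := Num.sqrt T; have t0 : 0 <= t by rewrite sqrtr_ge0.
have tT : t ^+ 2 = T by rewrite sqr_sqrtr // ltW.
have le_t z : 0 <= z -> z ^+ 2 <= T -> z <= t.
  by move=> z0; rewrite -tT ler_pXn2r ?nnegrE.
have {}Bx := le_t _ x0 Bx; have {}By := le_t _ y0 By.
have {}D : cn (x - y) <= e * t.
  rewrite -(@ler_pXn2r _ 2) ?nnegrE ?mulr_ge0 // ?(ltW e0) //.
  by rewrite exprMn tT.
rewrite subr_sqr normrM -tT (ger0_norm (addr_ge0 x0 y0)).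
apply: (@le_trans _ _ (e * t * (2 * t))); last by rewrite le_eqVlt; apply/orP; left; apply/eqP; ring.
by apply: ler_pM => //; [exact: addr_ge0 | exact: (le_trans dxy D) | lra].
Qed.

Lemma wedge2_close v w (eps B : R) : 0 <= eps ->
  (forall j, cn (v 0 j - w 0 j) <= eps) -> (forall j, cn (w 0 j) <= B) ->
  wedge2 v w <= (n.+1)%:R * ((n.+1)%:R * (2 * B * eps) ^+ 2).
Proof.
move=> eps0 vw wB.
have K0 : 0 <= (2 * B * eps) ^+ 2 by exact: sqr_ge0.
have t i j : cn (v 0 i * w 0 j - v 0 j * w 0 i) ^+ 2 <= (2 * B * eps) ^+ 2.
  have B0 : 0 <= B by apply: le_trans (wB i); exact: cn_ge0.
  rewrite ler_pXn2r ?nnegrE ?cn_ge0 ?mulr_ge0 //.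
  rewrite (_ : _ - _ = (v 0 i - w 0 i) * w 0 j - (v 0 j - w 0 j) * w 0 i); last by ring.
  apply: le_trans (cnB _ _) _.
  have := cn_bound_mul (vw i) (wB j); have := cn_bound_mul (vw j) (wB i).
  lra.
pose K := (n.+1)%:R * (2 * B * eps) ^+ 2.
apply: (@le_trans _ _ (\sum_(i < n.+1) K)); last first.
  by rewrite sumr_const card_ord [leRHS]mulr_natl.
apply: ler_sum => i _; rewrite /K.
apply: (@le_trans _ _ (\sum_(j < n.+1) (2 * B * eps) ^+ 2)).
  rewrite big_mkcond /=; apply: ler_sum => j _; case: ifP => // _.
by rewrite sumr_const card_ord [leRHS]mulr_natl.
Qed.

End AnyDimension.

Lemma homog_vec0 n (z : 'rV[C]_n) : homog_vec z 0 ord0 = 1.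
Proof.
rewrite (_ : ord0 = lshift n (0 : 'I_1)); last exact: val_inj.
by rewrite [LHS](row_mxEl (1%:M : 'rV_1)) mxE eqxx.
Qed.

Lemma homog_vecS n (z : 'rV[C]_n) j : homog_vec z 0 (lift ord0 j) = z 0 j.
Proof.
rewrite (_ : lift ord0 j = rshift 1 j); last exact: val_inj.
by rewrite [LHS](row_mxEr (1%:M : 'rV_1)).
Qed.

Lemma sqnorm_homog n (z : 'rV[C]_n) :
  sqnorm (homog_vec z) = 1 + \sum_j cn (z 0 j) ^+ 2.
Proof.
rewrite /sqnorm big_ord_recl homog_vec0 cn1 expr1n; congr (_ + _).
by apply: eq_bigr => j _; rewrite homog_vecS.
Qed.

Lemma hcoord_affine n (z : 'rV[C]_n) :
  exists2 c, c != 0 & hcoord (affine z) = c *: homog_vec z.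
Proof. exact: hcoord_pt. Qed.

Lemma hcoord_affine0 n (z : 'rV[C]_n) : hcoord (affine z) 0 ord0 != 0.
Proof.
by have [c c0 ->] := hcoord_affine z; rewrite mxE homog_vec0 mulr1.
Qed.

Lemma chart0_affine n (z : 'rV[C]_n) : chart ord0 (affine z) = z.
Proof.
rewrite /chart; have [c c0 ->] := hcoord_affine z; apply/rowP => j.
have E i : (c *: homog_vec z) 0 i = c * homog_vec z 0 i by rewrite mxE.
by rewrite [LHS]mxE [LHS]mxE !E homog_vec0 homog_vecS mulr1 mulKf.
Qed.

End Projective.

(** * Equicontinuity of normal families *)
Section ComplexRowTopology.
Variable R : realType.
Local Notation C := (Cplx R).

Definition nearby n (r : R) (z w : 'rV[C]_n) := forall j, cn (w 0 j - z 0 j) < r.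

Lemma nbhs_nearbyP n (z : 'rV[C]_n) (A : set 'rV[C]_n) :
  nbhs z A <-> exists2 r : R, 0 < r & forall w, nearby r z w -> A w.
Proof.
split=> [/nbhs_ballP[e /= /posC_ofR[r r0 ->] zA]|[r r0 zA]].
  exists r => // w zw; apply: zA; split=> [|i j]; first by rewrite -ofR0 ofR_lt.
  by rewrite ord1 /ball /= normE ofR_lt cnBC.
apply/nbhs_ballP; exists (ofR r) => /=; first by rewrite -ofR0 ofR_lt.
move=> w [_ zw]; apply: zA => j.
by have := zw 0 j; rewrite /ball /= normE ofR_lt cnBC.
Qed.

Lemma nearby_refl n (r : R) (z : 'rV[C]_n) : 0 < r -> nearby r z z.
Proof. by move=> r0 j; rewrite subrr cn0. Qed.

Lemma cn_continuous : continuous (fun z : C => cn z : R^o).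
Proof.
move=> z A /nbhs_ballP[e /= e0 eA]; apply/nbhs_ballP.
exists (ofR e) => /=; first by rewrite -ofR0 ofR_lt.
move=> w; rewrite /ball /= normE ofR_lt => zw; apply: eA.
exact: le_lt_trans (cn_dist _ _) zw.
Qed.

Lemma cn_coord_continuous n (j : 'I_n) :
  continuous (fun z : 'rV[C]_n => cn (z 0 j) : R^o).
Proof.
move=> z; apply: (@continuous_comp _ _ _ (fun z : 'rV[C]_n => z 0 j) (@cn R)).
  exact: coord_continuous.
exact: cn_continuous.
Qed.

Lemma cn_coord_sqr_continuous n (j : 'I_n) :
  continuous (fun z : 'rV[C]_n => cn (z 0 j) ^+ 2 : R^o).
Proof. by move=> z; have c := @cn_coord_continuous n j z; exact: (cvgM c c). Qed.

Lemma sum_continuous (T : topologicalType) (I : Type) (r : seq I) (f : I -> T -> R^o) :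
  (forall j, continuous (f j)) -> continuous (fun z => \sum_(j <- r) f j z : R^o).
Proof.
move=> fc; elim: r => [|j r IH].
  rewrite (_ : (fun z => _) = (fun=> 0 : R^o)); first by move=> z; exact: cst_continuous.
  by apply/funext => z; rewrite big_nil.
rewrite (_ : (fun z => _) = (fun z => f j z + \sum_(j <- r) f j z : R^o)).
  by move=> z; exact: (cvgD (fc j z) (IH z)).
by apply/funext => z; rewrite big_cons.
Qed.

Lemma share_affine_continuous n (i : 'I_n.+1) :
  continuous (fun z : 'rV[C]_n => share i (affine z) : R^o).
Proof.
have num_cont : continuous (fun z : 'rV[C]_n => cn (homog_vec z 0 i) ^+ 2 : R^o).
  case: (unliftP ord0 i) => [j ->|->].
    rewrite (_ : (fun z => _) = (fun z : 'rV[C]_n => cn (z 0 j) ^+ 2 : R^o)).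
      exact: cn_coord_sqr_continuous.
    by apply/funext => z; rewrite homog_vecS.
  rewrite (_ : (fun z => _) = (fun=> cn (1 : C) ^+ 2 : R^o)).
    by move=> z; exact: cst_continuous.
  by apply/funext => z; rewrite homog_vec0.
have den_cont : continuous (fun z : 'rV[C]_n => sqnorm (homog_vec z) : R^o).
  rewrite (_ : (fun z => _) =
      (fun z : 'rV[C]_n => 1 + \sum_j cn (z 0 j) ^+ 2 : R^o)); last first.
    by apply/funext => z; rewrite sqnorm_homog.
  have sc := @sum_continuous _ _ (index_enum 'I_n) _ (@cn_coord_sqr_continuous n).
  move=> z; have c1 : (fun=> 1 : R^o) @ z --> (1 : R^o) by exact: cst_continuous.
  exact: (cvgD c1 (sc z)).
rewrite (_ : (fun z => _) =
    (fun z : 'rV[C]_n => cn (homog_vec z 0 i) ^+ 2 / sqnorm (homog_vec z) : R^o)).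
  move=> z; have N0 : sqnorm (homog_vec z) != 0.
    by rewrite gt_eqF // sqnorm_gt0 // homog_vec_neq0.
  exact: (cvgM (num_cont z) (cvgV N0 (den_cont z))).
by apply/funext => w; rewrite share_pt.
Qed.

Lemma compact_convergent (T : topologicalType) (u : nat -> T) (l : T) :
  u @ \oo --> l -> compact ([set l] `|` range u).
Proof.
move=> ul F FF FK.
have [lF|] := pselect (cluster F l); first by exists l; split=> //; left.
move=> /existsNP[A] /existsNP[B] /not_implyP[FA] /not_implyP[lB] AB.
have [N _ NB] := ul _ lB.
have finE : compact (u @` `I_N).
  by apply: finite_compact; apply: finite_image; exact: finite_II.
have FE : F (u @` `I_N).
  apply: filterS (filterI FA FK) => x [Ax [xl|[m _ mx]]].
    exfalso; apply: AB; exists x; split=> //.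
    by rewrite xl; exact: nbhs_singleton.
  have [mN|Nm] := ltnP m N; first by exists m.
  by exfalso; apply: AB; exists x; split=> //; rewrite -mx; exact: NB.
have [x [[m _ mx] cx]] := finE F FF FE.
by exists x; split=> //; right; exists m.
Qed.

End ComplexRowTopology.

Section Subsequences.

Lemma extract_subsequence (P : nat -> Prop) :
  (forall K, exists2 k, (K <= k)%N & P k) ->
  exists s : nat -> nat, {homo s : i j / (i < j)%N} /\ forall i, P (s i).
Proof.
move=> H; have [g gP] : {g : nat -> nat & forall K, (K <= g K)%N /\ P (g K)}.
  by apply: (@choice _ _ (fun K k => (K <= k)%N /\ P k)) => K; have [k ? ?] := H K; exists k.
pose s := fix s i := if i is i'.+1 then g (s i').+1 else g 0%N.
exists s; split; last by case=> [|i]; exact: (gP _).2.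
by apply: homo_ltn => [? ? ?|i]; [exact: ltn_trans | exact: (gP _).1].
Qed.

Lemma frequently_or (P Q : nat -> Prop) :
  (forall K, exists2 k, (K <= k)%N & P k \/ Q k) ->
  (forall K, exists2 k, (K <= k)%N & P k) \/ (forall K, exists2 k, (K <= k)%N & Q k).
Proof.
move=> H; apply: contrapT => /not_orP[/existsNP[K1 H1] /existsNP[K2 H2]].
have [k kK [Pk|Qk]] := H (maxn K1 K2).
  by apply: H1; exists k => //; apply: leq_trans kK; exact: leq_maxl.
by apply: H2; exists k => //; apply: leq_trans kK; exact: leq_maxr.
Qed.

Lemma homo_ltn_ge (s : nat -> nat) : {homo s : i j / (i < j)%N} ->
  forall i, (i <= s i)%N.
Proof. by move=> sh; elim=> // i IH; apply: leq_ltn_trans IH (sh _ _ (ltnSn i)). Qed.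

End Subsequences.

Section Equicontinuity.
Variable R : realType.
Variable n : nat.
Local Notation C := (Cplx R).
Variable F : 'rV[C]_n -> 'rV[C]_n.
Hypothesis Fcont : forall k, continuous (iter k F).

(** Otherwise points w_m tending to z carry iterates whose shares differ from
    those at z by more than e.  The points w_m and their limit form a compact
    set, on which a subsequence of these iterates converges uniformly: the
    shares along it are then close to that of one fixed, continuous iterate. *)
Lemma normal_equicontinuous (X : set 'rV[C]_n) z (i : 'I_n.+1) (e : R) :
  open_nbhs z X ->
  normal_on X [set g | exists k, (0 < k)%N /\ g = @affine R n \o iter k F] ->
  0 < e -> exists2 r : R, 0 < r & forall w k, nearby r z w -> (0 < k)%N ->
    `|share i (affine (iter k F w)) - share i (affine (iter k F z))| <= e.
Proof.
move=> zX nX e0; apply: contrapT => none.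
have /nbhs_nearbyP[d d0 dX] : nbhs z X by exact: open_nbhs_nbhs.
have /choice[u uP] : forall m : nat, exists wk : 'rV[C]_n * nat,
    [/\ nearby (d / m.+1%:R) z wk.1, (0 < wk.2)%N &
     e < `|share i (affine (iter wk.2 F wk.1)) - share i (affine (iter wk.2 F z))|].
  move=> m; apply: contrapT => H; apply: none; exists (d / m.+1%:R).
    by rewrite divr_gt0.
  move=> w k zw k0; rewrite leNgt; apply/negP => ew; apply: H.
  by exists (w, k).
pose w m := (u m).1; pose k m := (u m).2.
have [m|s [h [sh _ hcvg]]] := nX (fun m => @affine R n \o iter (k m) F).
  by exists (k m); split=> //; have [] := uP m.
have nearby_le r r' (x y : 'rV[C]_n) : r <= r' -> nearby r x y -> nearby r' x y.
  by move=> rr xy j; exact: lt_le_trans rr.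
have wz : w @ \oo --> z.
  move=> A /nbhs_nearbyP[r r0 rA].
  exists (Num.bound (d / r)) => // m /= mr; apply: rA.
  have [wm _ _] := uP m; apply: nearby_le wm.
  rewrite ler_pdivrMr // mulrC -ler_pdivrMr //.
  have dr0 : 0 <= d / r by rewrite ltW // divr_gt0.
  apply: le_trans (ltW (archi_boundP dr0)) _.
  by rewrite ler_nat; apply: leqW.
pose K := [set z] `|` range w.
have KX : K `<=` X.
  move=> x [->|[m _ <-]]; first by apply: dX; exact: nearby_refl.
  apply: dX; have [wm _ _] := uP m; apply: nearby_le wm.
  by rewrite ler_pdivrMr // ler_peMr ?ler1n // ltW.
(* Chordal accuracy giving shares up to e / 6; the comparison of the two
   iterates at w_m and z goes through five such estimates. *)
pose q := e / 6 / ((n.+1)%:R * 2).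
have K0 : 0 < (n.+1)%:R * 2 :> R by rewrite mulr_gt0.
have q0 : 0 < q by rewrite !divr_gt0.
have q0C : 0 < ofR q by rewrite -ofR0 ofR_lt.
have [N _ NP] := hcvg K (compact_convergent wz) KX _ q0C.
have near_h m x : (N <= m)%N -> K x ->
    `|share i (affine (iter (k (s m)) F x)) - share i (h x)| <= e / 6.
  move=> Nm Kx; have := share_lip i q0 (NP m Nm x Kx).
  by rewrite mulrA /q [_ * (e / 6 / _)]mulrC divfK // gt_eqF.
have cphi : {for z, continuous (fun x => share i (affine (iter (k (s N)) F x)) : R^o)}.
  apply: (@continuous_comp _ _ _ (iter (k (s N)) F)
    (fun x : 'rV[C]_n => share i (affine x) : R^o)); first exact: Fcont.
  exact: share_affine_continuous.
have e6 : 0 < e / 6 by rewrite divr_gt0.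
have /cvgrPdist_le /(_ _ e6) := cphi.
move=> /nbhs_nearbyP[r r0 rP].
have [M _ MP] : \forall m \near \oo, nearby r z (w m).
  by apply: wz; apply/nbhs_nearbyP; exists r.
pose m := maxn N M.
have sm : (M <= s m)%N by apply: leq_trans (homo_ltn_ge sh m); exact: leq_maxr.
have H1 := rP _ (MP _ sm).
have Kw : K (w (s m)) by right; exists (s m).
have Kz : K z by left.
have H2 := near_h N _ (leqnn N) Kw; have H3 := near_h N _ (leqnn N) Kz.
have H4 := near_h m _ (leq_maxl N M) Kw; have H5 := near_h m _ (leq_maxl N M) Kz.
have [_ _] := uP (s m); rewrite -/(w _) -/(k _).
move: H1 H2 H3 H4 H5; rewrite !ler_norml => /andP[? ?] /andP[? ?] /andP[? ?] /andP[? ?] /andP[? ?].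
by rewrite ltNge => /negP; apply; rewrite ler_norml; apply/andP; split; lra.
Qed.

End Equicontinuity.

(** * Points whose orbits escape with prescribed ratios *)
Section ShiftMap.
Variable R : realType.
Local Notation C := (Cplx R).
Variable f : C -> C.
Variable a : C.
Hypothesis fjet : forall z, jet_at 3 f z.
Hypothesis fentire : entire f.

Local Notation F := (@shift_like R 2 1 a f).

(** The coordinates of the n-th iterate are the terms n, n + 1, n + 2 of this
    scalar sequence, see [orb_coord]. *)
Definition orb (z : 'rV[C]_3) (n : nat) : C := iter n F z 0 ord0.

Lemma orb_coord z n j : (j < 3)%N -> iter n F z 0 (inord j) = orb z (n + j).
Proof.
elim: j n => [|j IH] n j3.
  by rewrite addn0 /orb; congr (_ _ _); apply: val_inj; rewrite /= inordK.
rewrite addnS -addSn -IH ?(ltnW j3) // iterS [in RHS]/shift_like mxE.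
by rewrite inordK ?(ltnW j3) // -ltnS j3.
Qed.

Lemma orb_rec z n : orb z n.+3 = f (orb z n.+2) - a * orb z n.
Proof.
rewrite -(addn2 n.+1) -orb_coord // iterS [in LHS]/shift_like mxE inordK //=.
by rewrite orb_coord // addn2.
Qed.

Lemma orb_init z (i : 'I_3) : orb z i = z 0 i.
Proof.
rewrite -[LHS]/(orb z (0 + i)) -orb_coord //=; congr (z _ _).
by apply: val_inj; rewrite /= inordK.
Qed.

Lemma orb_iter z n m : orb (iter n F z) m = orb z (n + m).
Proof. by rewrite /orb addnC iterD. Qed.

Lemma shift_differentiable z : differentiable F z.
Proof.
have coordD (j : 'I_3) : differentiable (fun w : 'rV[C]_3 => w 0 j) z.
  exact: differentiable_coord.
have -> : F = \sum_(j < 3) (fun w => F w 0 j *: delta_mx 0 j).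
  apply/funext => w; rewrite fct_sumE [LHS]row_sum_delta.
  by apply: eq_bigr.
apply: differentiable_sum => j; apply: differentiableZl.
rewrite /shift_like; case: (ltnP j 2) => j2.
  rewrite (_ : (fun w => _) = (fun w : 'rV[C]_3 => w 0 (inord j.+1))) //.
  by apply/funext => w; rewrite mxE j2.
rewrite (_ : (fun w => _) =
  (f \o (fun w : 'rV[C]_3 => w 0 (inord 2))) - (a *: (fun w : 'rV[C]_3 => w 0 ord0))).
  apply: differentiableB; last exact: differentiableZ (coordD _).
  apply: differentiable_comp; first exact: coordD.
  by apply/derivable1_diffP; exact: fentire.
by apply/funext => w; rewrite mxE ltnNge j2.
Qed.

Lemma iter_differentiable n z : differentiable (iter n F) z.
Proof.
elim: n => [|n IH]; first exact: ex_diff.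
rewrite (_ : iter n.+1 F = F \o iter n F) //.
by apply: differentiable_comp; [exact: IH | exact: shift_differentiable].
Qed.

Lemma iter_continuous n : continuous (iter n F).
Proof. by move=> z; apply: differentiable_continuous; exact: iter_differentiable. Qed.

Lemma orb_jet (d u : 'rV[C]_3) n t : jet_at 3 (fun t => orb (d + t *: u) n) t.
Proof.
elim/ltn_ind: n => n IH.
have [n3|n3] := ltnP n 3.
  apply: (@jet_ext _ _ (fun h => d 0 (Ordinal n3) + (t + h) * u 0 (Ordinal n3)) _ 1) => //.
    by move=> h _; rewrite (orb_init _ (Ordinal n3)) !mxE.
  apply: jetD; first exact: jet_cst.
  apply: jetM; last exact: jet_cst.
  exact: (jet_at_id 3 t).
case: n n3 IH => [|[|[|n]]] // _ IH.
apply: (@jet_ext _ _ (fun h => f (orb (d + (t + h) *: u) n.+2) -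
    a * orb (d + (t + h) *: u) n) _ 1) => // [h _|]; first by rewrite orb_rec.
apply: jetB.
  apply: (@jet_at_comp _ 2 f (fun t => orb (d + t *: u) n.+2)); first exact: fjet.
  exact: IH.
apply: jetM; first exact: jet_cst.
apply: IH; exact: (leq_trans (ltnSn n) (leqW (leqnSn _))).
Qed.

(** The share of the first affine coordinate, which is the homogeneous
    coordinate of index 1: it stays away from 0 exactly when 1, x_(n+1) and
    x_(n+2) are bounded by a multiple of x_n. *)
Definition share1 (z : 'rV[C]_3) : R := share (lift ord0 ord0) (affine z).

Lemma share1_orb z n : share1 (iter n F z) =
  cn (orb z n) ^+ 2 /
  (1 + cn (orb z n) ^+ 2 + cn (orb z n.+1) ^+ 2 + cn (orb z n.+2) ^+ 2).
Proof.
have c j : (j < 3)%N -> iter n F z 0 (inord j) = orb z (n + j) by exact: orb_coord.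
rewrite /share1 share_pt homog_vecS sqnorm_homog.
rewrite !big_ord_recl big_ord0 addr0.
have -> : lift ord0 ord0 = inord 1 :> 'I_3 by apply: val_inj; rewrite /= inordK.
have -> : lift ord0 (lift ord0 ord0) = inord 2 :> 'I_3.
  by apply: val_inj; rewrite /= inordK.
by rewrite !c // addn1 addn2 !addrA.
Qed.

Section Asymptotics.
Variable rho : nat -> R.
Hypothesis rho_bounds : forall n, 2 <= rho n <= 3.

Definition tracks (e : R) n z := [/\ orb z n != 0, cn (orb z n)^-1 <= e &
  cn (orb z n.+1 / orb z n - ofR (rho n)) <= e].

Definition tracking_set : set 'rV[C]_3 := [set z | exists2 r : R, 0 < r &
  forall e : R, 0 < e -> exists N, forall n w, (N <= n)%N -> nearby r z w ->
    tracks e n w].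

Lemma open_tracking_set : open tracking_set.
Proof.
rewrite openE => z [r r0 zr]; apply/nbhs_nearbyP; exists (r / 2).
  by rewrite divr_gt0.
move=> w zw; exists (r / 2); first by rewrite divr_gt0.
move=> e /zr[N NP]; exists N => n x Nn wx; apply: NP => // j.
rewrite (_ : _ - _ = (x 0 j - w 0 j) + (w 0 j - z 0 j)); last by ring.
by apply: le_lt_trans (cnD _ _) _; have := wx j; have := zw j; lra.
Qed.

Lemma cn_rho n : cn (ofR (rho n) : C) <= 3.
Proof. by have /andP[? ?] := rho_bounds n; rewrite cn_ofR ger0_norm; lra. Qed.

Lemma tracks_ratio n z e : e <= 1 -> tracks e n z -> cn (orb z n.+1) <= 4 * cn (orb z n).
Proof.
move=> e1 [z0 _ zr].
have -> : orb z n.+1 = (orb z n.+1 / orb z n - ofR (rho n) + ofR (rho n)) * orb z n.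
  by rewrite subrK divfK.
have := cn_bound_mul (cn_bound_add zr (cn_rho n)) (lexx (cn (orb z n))).
have := cn_ge0 (orb z n); nra.
Qed.

(** Here |x_(n+1)| <= 4 |x_n| and |x_(n+2)| <= 16 |x_n|, and 1 + 1 + 16 + 256
    is less than 300. *)
Lemma tracks_share z n : tracks 1 n z -> tracks 1 n.+1 z -> 300^-1 <= share1 (iter n F z).
Proof.
move=> t t'; have r1 := tracks_ratio (lexx _) t; have r2 := tracks_ratio (lexx _) t'.
rewrite share1_orb; have [z0 zi _] := t.
have x0 : 0 < cn (orb z n) by rewrite cn_gt0.
have x1 : 1 <= cn (orb z n).
  by move: zi; rewrite cnV invf_le1.
move: r1 r2 x1 (cn_ge0 (orb z n.+1)) (cn_ge0 (orb z n.+2)).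
move: (cn (orb z n)) (cn (orb z n.+1)) (cn (orb z n.+2)) => x y w r1 r2 x1 y0 w0.
have y2 : y ^+ 2 <= (4 * x) ^+ 2 by rewrite ler_pXn2r ?nnegrE //; lra.
have w2 : w ^+ 2 <= (16 * x) ^+ 2 by rewrite ler_pXn2r ?nnegrE //; lra.
have x2 : 1 <= x ^+ 2 by rewrite exprn_ege1.
have [y2' w2'] : 0 <= y ^+ 2 /\ 0 <= w ^+ 2 by rewrite !sqr_ge0.
rewrite ler_pdivlMr; last lra.
rewrite exprMn in y2; rewrite exprMn in w2.
have : (4 : R) ^+ 2 = 16 by ring.
have : (16 : R) ^+ 2 = 256 by ring.
nra.
Qed.

Lemma share_bounds z n : 1600^-1 <= share1 (iter n F z) ->
  [/\ orb z n != 0, cn (orb z n)^-1 <= 40 & cn (orb z n.+1 / orb z n) <= 40].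
Proof.
rewrite share1_orb; set D := 1 + _ + _ + _.
have D0 : 0 < D.
  by rewrite /D; have := sqr_ge0 (cn (orb z n)); have := sqr_ge0 (cn (orb z n.+1));
    have := sqr_ge0 (cn (orb z n.+2)); lra.
rewrite ler_pdivlMr // => H.
have s0 := sqr_ge0 (cn (orb z n)); have s1 := sqr_ge0 (cn (orb z n.+1)).
have s2 := sqr_ge0 (cn (orb z n.+2)).
have H' : D <= 1600 * cn (orb z n) ^+ 2 by lra.
have z0 : orb z n != 0.
  by apply/eqP => E; rewrite E cn0 expr0n /= mulr0 in H'; lra.
have x0 : 0 < cn (orb z n) by rewrite cn_gt0.
have c40 : 1600 = 40 ^+ 2 :> R by ring.
split=> //.
  rewrite cnV -div1r ler_pdivrMr // -(@ler_pXn2r _ 2) ?nnegrE ?mulr_ge0 ?cn_ge0 //.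
  by rewrite expr1n exprMn -c40; rewrite /D in H'; lra.
rewrite cnM cnV ler_pdivrMr // -(@ler_pXn2r _ 2) ?nnegrE ?mulr_ge0 ?cn_ge0 //.
by rewrite exprMn -c40; rewrite /D in H'; lra.
Qed.

(** On a complex line through a tracking point d near z and an arbitrary point w
    near z, the functions 1 / x_n and x_(n+1) / x_n - rho_n are bounded, and
    small near d.  By [small_propagates] they are small at w. *)
Lemma closed_tracking_set z : fatou_set F z -> closure tracking_set z ->
  tracking_set z.
Proof.
move=> [X [zX nX]] zcl.
have e0 : 0 < 1000^-1 :> R by rewrite invr_gt0 ltr0n.
have [r r0 equi] := @normal_equicontinuous R 3 F iter_continuous X z
  (lift ord0 ord0) _ zX nX e0.
have [d [[rd rd0 dP] zd]] := zcl _ (proj2 (nbhs_nearbyP z (nearby (r / 8) z))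
  (ex_intro2 _ _ (r / 8) (divr_gt0 r0 (ltr0Sn _ 7)) (fun w H => H))).
have [N0 N0P] := dP 1 ltr01.
have dd := nearby_refl d rd0.
have zd' : nearby r z d by move=> j; apply: lt_trans (zd j) _; lra.
have bnd w n : (N0 <= n)%N -> (0 < n)%N -> nearby r z w ->
    [/\ orb w n != 0, cn (orb w n)^-1 <= 40 & cn (orb w n.+1 / orb w n) <= 40].
  move=> Nn n0 zw; apply: share_bounds.
  have := tracks_share (N0P _ _ Nn dd) (N0P _ _ (leqW Nn) dd).
  have := equi _ _ zw n0; have := equi _ _ zd' n0; rewrite -!/(share1 _) !ler_norml.
  by move=> /andP[? ?] /andP[? ?] ?; lra.
exists (r / 8); first by rewrite divr_gt0.
move=> e e_gt0.
(* On the line through d and w, the disc of radius tau stays in the ball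
   around d where tracking is uniform, and the disc of radius 2 stays in the
   ball around z where the bounds hold. *)
pose tau := Num.min 1 (rd / r).
have tau0 : 0 < tau by rewrite lt_min ltr01 divr_gt0.
have tau1 : tau <= 1 by rewrite ge_min lexx.
have taur : tau * r <= rd by rewrite -ler_pdivlMr // ge_min lexx orbT.
(* The ratio x_(n+1) / x_n is bounded by 40 and rho_n by 3. *)
have [p pP] : exists p : nat, 43 / 2 ^+ p <= e / 2.
  exists (Num.bound (43 / (e / 2))).
  have q0 : 0 <= 43 / (e / 2) by rewrite ltW // !divr_gt0.
  rewrite ler_pdivrMr ?exprn_gt0 // mulrC -ler_pdivrMr ?divr_gt0 //.
  apply: le_trans (ltW (archi_boundP q0)) _.
  by rewrite -natrX ler_nat ltnW // ltn_expl.
have eta0 : 0 < e / 2 * tau ^+ p by rewrite mulr_gt0 ?divr_gt0 ?exprn_gt0.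
have [N NP] := dP _ eta0.
exists (maxn N0 (maxn N 1)) => n w; rewrite !geq_max => /and3P[N0n Nn n0] zw.
pose phi t := d + t *: (w - d).
have wd j : cn (w 0 j - d 0 j) < r / 4.
  rewrite (_ : _ - _ = (w 0 j - z 0 j) - (d 0 j - z 0 j)); last by ring.
  by apply: le_lt_trans (cnB _ _) _; have := zw j; have := zd j; lra.
have phi_z t : cn t <= 2 -> nearby r z (phi t).
  move=> t2 j; rewrite /phi !mxE.
  rewrite (_ : _ - _ = (d 0 j - z 0 j) + t * (w 0 j - d 0 j)); last by ring.
  have := cn_bound_add (ltW (zd j)) (cn_bound_mul t2 (ltW (wd j))).
  by move=> H; apply: le_lt_trans H _; lra.
have phi_d t : cn t <= tau -> nearby rd d (phi t).
  move=> tt j; rewrite /phi !mxE addrAC subrr add0r.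
  apply: le_lt_trans (cn_bound_mul tt (ltW (wd j))) _.
  by rewrite mulrA; lra.
have phi1 : phi 1 = w by rewrite /phi scale1r addrC subrK.
have fin g : (forall t, cn t <= 2 -> jet_at 3 g t) ->
    (forall t, cn t <= tau -> cn (g t) <= e / 2 * tau ^+ p) ->
    (forall t, cn t <= 2 -> cn (g t) <= 43) -> cn (g 1) <= e.
  move=> g1 g2 g3.
  have := small_propagates p tau0 tau1 (ltW eta0) (ler0n _ 43) g1 g2 g3.
  rewrite mulfK ?expf_neq0 ?gt_eqF // => H; apply: le_trans H _.
  by rewrite [leRHS](splitr e) lerD2l.
have nz t : cn t <= 2 -> orb (phi t) n != 0.
  by move=> t2; have [] := bnd _ _ N0n n0 (phi_z _ t2).
have jn t : cn t <= 2 -> jet_at 3 (fun t => (orb (phi t) n)^-1) t.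
  move=> t2; apply: (@jetV _ 2 (fun h => orb (phi (t + h)) n)); first exact: orb_jet.
  by rewrite addr0 nz.
split.
- by rewrite -phi1 nz // cn1; lra.
- rewrite -phi1; apply: (fin (fun t => (orb (phi t) n)^-1)) => // t tt.
    by have [] := NP n _ Nn (phi_d _ tt).
  by have [_ H _] := bnd _ _ N0n n0 (phi_z _ tt); lra.
- rewrite -phi1.
  apply: (fin (fun t => orb (phi t) n.+1 / orb (phi t) n - ofR (rho n))) => t tt.
  + apply: jetB; last exact: jet_cst.
    by apply: jetM; [exact: orb_jet | exact: jn].
  + by have [] := NP n _ Nn (phi_d _ tt).
  + have [_ _ H] := bnd _ _ N0n n0 (phi_z _ tt).
    by apply: le_trans (cnB _ _) _; have := cn_rho n; lra.
Qed.

(** The component is connected, and the tracking set is open and closed in it. *)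
Lemma component_tracks z0 : tracking_set z0 -> fatou_set F z0 ->
  connected_component (fatou_set F) z0 `<=` tracking_set.
Proof.
move=> t0 f0; set U := connected_component _ _.
suff -> : U = U `&` tracking_set by move=> z [].
apply/esym/(@component_connected _ (fatou_set F) z0).
- by exists z0; split=> //; exact: connected_component_refl.
- by exists tracking_set => //; exact: open_tracking_set.
- exists (closure tracking_set); first exact: closed_closure.
  apply/seteqP; split=> z [Uz zt]; split=> //; first exact: subset_closure.
  by apply: closed_tracking_set => //; apply: connected_component_sub Uz.
Qed.

End Asymptotics.
End ShiftMap.

(** * The wandering domain *)
Arguments cn : simpl never.

Section WanderingDomain.
Variable R : realType.
Local Notation C := (Cplx R).
Local Notation f := (@bumps R).
Local Notation a := (ofR (shift_coef R)).
Local Notation F := (@shift_like R 2 1 a f).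
Local Notation node := (@node R).
Local Notation tolerance := (tolerance R).
Local Notation orb := (@orb R f a).

Definition rho n : R := (growth n)%:R.
Definition base : 'rV[C]_3 := \row_(j < 3) ofR (node j).
Definition radius : R := tolerance / node 2.
Definition cell : set 'rV[C]_3 := nearby radius base.

Lemma radius_gt0 : 0 < radius.
Proof. by rewrite divr_gt0 ?tolerance_gt0 ?node_gt0. Qed.

Lemma rho_bounds n : 2 <= rho n <= 3. Proof. exact: growth_bounds. Qed.

Lemma cell_shadow w n : cell w -> cn (orb w n - ofR (node n)) <= tolerance / node n.
Proof.
move=> Vw; apply: shadow_orbit n => [n|i i3]; first exact: orb_rec.
have := Vw (Ordinal i3); rewrite !mxE -(@orb_init R f a w (Ordinal i3)) /= => /ltW H.
apply: le_trans H _; rewrite /radius ler_pM2l ?tolerance_gt0 //.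
rewrite lef_pV2 ?posrE ?node_gt0 //.
have := node_geS R 0; have := node_geS R 1; have := node_gt0 R 0.
by case: i i3 => [|[|[|]]] //= _; lra.
Qed.

(** Errors at consecutive nodes are bounded, while x_n itself tends to
    infinity. *)
Lemma cell_tracks (e : R) : 0 < e ->
  exists N, forall n w, (N <= n)%N -> cell w -> tracks f a rho e n w.
Proof.
move=> e0; exists (Num.bound (2 / e)) => n w Nn Vw.
have X2 : 2 / e <= node n.
  have q0 : 0 <= 2 / e by rewrite ltW // divr_gt0.
  apply: le_trans (ltW (archi_boundP q0)) _.
  apply: (@le_trans _ _ n%:R); first by rewrite ler_nat.
  apply: (@le_trans _ _ (2 ^+ n)); first by rewrite -natrX ler_nat ltnW // ltn_expl.
  apply: le_trans (node_ge R n); rewrite ler_peMl ?exprn_ge0 //.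
  by have := scale_ge16 R; lra.
have x16 := node_ge16 R n; have x0 := node_gt0 R n.
have k0 := tolerance_gt0 R; have kE := toleranceE R.
have small m : tolerance / node m <= 16^-1.
  have i1 : (node m)^-1 <= 16^-1 by rewrite lef_pV2 ?posrE ?node_gt0 // node_ge16.
  have i0 : 0 < (node m)^-1 by rewrite invr_gt0 node_gt0.
  by nra.
have h0 := le_trans (cell_shadow n Vw) (small n).
have h1 := le_trans (cell_shadow n.+1 Vw) (small n.+1).
have lower : node n / 2 <= cn (orb w n).
  have := cn_dist (orb w n) (ofR (node n)); rewrite cn_ofR (gtr0_norm x0) ler_norml.
  by move=> /andP[? _]; lra.
have y0 : 0 < cn (orb w n) by apply: lt_le_trans lower; rewrite divr_gt0.
have inv : cn (orb w n)^-1 <= e.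
  rewrite cnV -div1r ler_pdivrMr //.
  by move: X2; rewrite ler_pdivrMr // => X2; nra.
have nz : orb w n != 0 by rewrite -cn_gt0.
split=> //.
have -> : orb w n.+1 / orb w n - ofR (rho n) =
    ((orb w n.+1 - ofR (node n.+1)) - ofR (rho n) * (orb w n - ofR (node n))) * (orb w n)^-1.
  by rewrite nodeS -/(rho n) ofRM; field.
rewrite -[leRHS]mul1r; apply: cn_bound_mul inv.
apply: le_trans (cnB _ _) _.
have := cn_bound_mul (cn_rho rho_bounds n) h0.
lra.
Qed.

Lemma base_cell : cell base. Proof. exact: nearby_refl radius_gt0. Qed.

Lemma base_tracking : tracking_set f a rho base.
Proof. by exists radius; [exact: radius_gt0 | exact: cell_tracks]. Qed.

Definition limit_vec (p q : R) : 'rV[C]_4 :=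
  \row_(j < 4) nth 0 [:: 0; 1; ofR p; ofR (p * q)] j.

Lemma limit_vec1 p q : limit_vec p q 0 (lift ord0 ord0) = 1.
Proof. by rewrite mxE. Qed.

Lemma limit_vec_neq0 p q : limit_vec p q != 0.
Proof.
apply/eqP => /rowP /(_ (lift ord0 ord0)); rewrite limit_vec1 mxE => /eqP.
by rewrite oner_eq0.
Qed.

Definition limit_pt p q := proj_pt (limit_vec_neq0 p q).

(** After division by x_n, the homogeneous coordinates of the n-th iterate are
    within 7 eps of those of the limit point, whose entries are at most 9; the
    wedge is then at most (4 . 2 . 9 . 7 eps)^2. *)
Lemma tracks_near_limit (eps e : R) n w : 0 < eps -> eps <= 1 -> 504 * eps < e ->
  tracks f a rho eps n w -> tracks f a rho eps n.+1 w ->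
  proj_dist (affine (iter n F w)) (limit_pt (rho n) (rho n.+1)) < ofR e.
Proof.
move=> eps0 eps1 epse t t'; have e0 : 0 < e by lra.
have [x0 xi xr] := t; have [x0' _ xr'] := t'.
rewrite proj_dist_pt_lt //; set L := limit_vec _ _.
set H := homog_vec _; set x := orb w n.
have Hx : H 0 (lift ord0 ord0) = x by rewrite homog_vecS.
have c0 : 0 < cn x^-1 ^+ 2 by rewrite exprn_gt0 // cn_gt0 invr_eq0.
rewrite -(ltr_pM2l c0).
have -> : cn x^-1 ^+ 2 * wedge2 H L = wedge2 (x^-1 *: H) L.
  by rewrite -[L in RHS]scale1r wedge2Z cn1 expr1n mulr1.
have -> : cn x^-1 ^+ 2 * (e ^+ 2 * (sqnorm H * sqnorm L)) =
    e ^+ 2 * (sqnorm (x^-1 *: H) * sqnorm L) by rewrite sqnormZ; ring.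
have N1 : 1 <= sqnorm (x^-1 *: H).
  by apply: le_trans (sqnorm_ge (lift ord0 ord0) _); rewrite mxE Hx mulVf // cn1 expr1n.
have N2 : 1 <= sqnorm L.
  by apply: le_trans (sqnorm_ge (lift ord0 ord0) _); rewrite limit_vec1 cn1 expr1n.
have eps7 : 0 <= 7 * eps by rewrite mulr_ge0 // ltW.
have /andP[p2 p3] := rho_bounds n; have /andP[q2 q3] := rho_bounds n.+1.
have LB j : cn (L 0 j) <= 9.
  rewrite mxE; case: j => -[|[|[|[|//]]]] ? /=.
  - by rewrite cn0.
  - by rewrite cn1; lra.
  - by rewrite cn_ofR ger0_norm; lra.
  - by rewrite cn_ofR ger0_norm; nra.
have close j : cn ((x^-1 *: H) 0 j - L 0 j) <= 7 * eps.
  have coord (i : 'I_3) : H 0 (lift ord0 i) = orb w (n + i).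
    by rewrite homog_vecS -orb_coord // inord_val.
  rewrite mxE; case: (unliftP ord0 j) => [i ->|->].
    rewrite coord mxE; case: i => -[|[|[|//]]] i3 /=.
    - by rewrite addn0 mulVf // subrr cn0.
    - by rewrite addn1 mulrC; lra.
    rewrite addn2 (_ : _ - _ = (orb w n.+2 / orb w n.+1 - ofR (rho n.+1)) *
      (orb w n.+1 / x - ofR (rho n) + ofR (rho n)) +
      ofR (rho n.+1) * (orb w n.+1 / x - ofR (rho n))); last first.
      by rewrite ofRM; field; rewrite ?x0' ?x0.
    have := cn_bound_add
      (cn_bound_mul xr' (cn_bound_add xr (cn_rho rho_bounds n)))
      (cn_bound_mul (cn_rho rho_bounds n.+1) xr).
    by move=> E; apply: le_trans E _; nra.
  rewrite homog_vec0 mxE /= mulr1 subr0; lra.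
apply: le_lt_trans (wedge2_close eps7 close LB) _.
have -> : 4%:R * (4%:R * (2 * 9 * (7 * eps)) ^+ 2) = (504 * eps) ^+ 2 :> R by ring.
have E0 : 0 <= 504 * eps by lra.
have E : (504 * eps) ^+ 2 < e ^+ 2.
  by move: (504 * eps) epse E0 => y ye y0; rewrite ltr_pXn2r ?nnegrE // ltW.
apply: lt_le_trans E _; rewrite ler_peMr ?exprn_ge0 ?(ltW e0) //.
by rewrite -[leLHS]mulr1 ler_pM.
Qed.

Lemma holomorphic_affine_iter k (V : set 'rV[C]_3) :
  holomorphic_proj V (@affine R 3 \o iter k F).
Proof.
move=> z _; exists ord0; apply/nbhs_nearbyP; exists 1 => // w _; split; first exact: hcoord_affine0.
rewrite (_ : _ \o _ = iter k F); last first.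
  by apply/funext => x; rewrite /= chart0_affine.
by apply: iter_differentiable; exact: bumps_entire.
Qed.

Lemma holomorphic_cst p q (V : set 'rV[C]_3) :
  holomorphic_proj V (fun=> limit_pt p q).
Proof.
move=> z _; exists (lift ord0 ord0); apply/nbhs_nearbyP; exists 1 => // w _; split.
  by have [c c0 ->] := hcoord_pt (limit_vec_neq0 p q); rewrite !mxE mulr1.
exact: differentiable_cst.
Qed.

Lemma proj_dist_refl n (p : Defs.proj R n) (e : R) : 0 < e -> proj_dist p p < ofR e.
Proof.
move=> e0; rewrite proj_dist_lt //.
have -> : wedge2 (hcoord p) (hcoord p) = 0.
  rewrite /wedge2 big1 // => i _; rewrite big1 // => j _.
  by rewrite mulrC subrr cn0 expr0n.
by rewrite !mulr_gt0 ?exprn_gt0 ?sqnorm_gt0 ?hcoord_neq0.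
Qed.

(** Either some iterate occurs infinitely often in the sequence, or the orders
    of the iterates tend to infinity; in that case one of the four pairs of
    consecutive ratios occurs infinitely often. *)
Lemma cell_normal :
  normal_on cell [set g | exists k, (0 < k)%N /\ g = @affine R 3 \o iter k F].
Proof.
move=> g gP; have [k kP] : {k : nat -> nat & forall m, g m = @affine R 3 \o iter (k m) F}.
  by apply: (@choice _ _ (fun m k => g m = @affine R 3 \o iter k F)) => m;
    have [k [_ ?]] := gP m; exists k.
have [[n nP]|kinf] := pselect (exists n, forall K, exists2 m, (K <= m)%N & k m = n).
  have [s [sh sn]] := extract_subsequence nP.
  exists s, (@affine R 3 \o iter n F); split=> //.
    exact: holomorphic_affine_iter.
  move=> K _ _ e /posC_ofR[d d0 ->]; exists 0%N => // m _ z _.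
  by rewrite /= kP sn; exact: proj_dist_refl.
have kbig N : exists K, forall m, (K <= m)%N -> (N <= k m)%N.
  elim: N => [|N [K KP]]; first by exists 0%N.
  have [K' K'P] : exists K, forall m, (K <= m)%N -> k m != N.
    apply: contrapT => H; apply: kinf; exists N => K'.
    apply: contrapT => H'; apply: H; exists K' => m Km.
    by apply/eqP => E; apply: H'; exists m.
  exists (maxn K K') => m; rewrite geq_max => /andP[/KP Nm /K'P E].
  by rewrite ltn_neqAle eq_sym E.
have pairs : exists p q, forall K, exists2 m, (K <= m)%N &
    rho (k m) = p /\ rho (k m).+1 = q.
  have two n : rho n = 3 \/ rho n = 2.
    by rewrite /rho /growth; case: ifP; [left | right].
  have [H|H] : (forall K, exists2 m, (K <= m)%N & rho (k m) = 3) \/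
      (forall K, exists2 m, (K <= m)%N & rho (k m) = 2).
  - by apply: frequently_or => K; exists K.
  - have [H'|H'] : (forall K, exists2 m, (K <= m)%N & rho (k m) = 3 /\ rho (k m).+1 = 3)
      \/ (forall K, exists2 m, (K <= m)%N & rho (k m) = 3 /\ rho (k m).+1 = 2).
      apply: frequently_or => K; have [m Km E] := H K; exists m => //.
      by case: (two (k m).+1) => ?; [left | right].
    + by exists 3, 3.
    + by exists 3, 2.
  - have [H'|H'] : (forall K, exists2 m, (K <= m)%N & rho (k m) = 2 /\ rho (k m).+1 = 3)
      \/ (forall K, exists2 m, (K <= m)%N & rho (k m) = 2 /\ rho (k m).+1 = 2).
      apply: frequently_or => K; have [m Km E] := H K; exists m => //.
      by case: (two (k m).+1) => ?; [left | right].
    + by exists 2, 3.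
    + by exists 2, 2.
have [p [q /extract_subsequence[s [sh sP]]]] := pairs.
exists s, (fun=> limit_pt p q); split=> //; first exact: holomorphic_cst.
move=> K _ KV e /posC_ofR[d d0 ->].
pose eps := Num.min 1 (d / 505).
have d5 : 0 < d / 505 by apply: divr_gt0 d0 _; rewrite ltr0n.
have eps0 : 0 < eps by rewrite lt_min ltr01.
have eps1 : eps <= 1 by rewrite ge_min lexx.
have epsd : 504 * eps < d.
  have : eps <= d / 505 by rewrite ge_min lexx orbT.
  by lra.
have [N NP] := cell_tracks eps0; have [M MP] := kbig N.
exists M => // m /= Mm z /KV Vz.
have Nm : (N <= k (s m))%N by apply: MP; apply: leq_trans (homo_ltn_ge sh m).
rewrite kP; have [<- <-] := sP m.
by apply: tracks_near_limit eps0 eps1 epsd _ _; apply: NP => //; exact: leqW.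
Qed.

Lemma base_fatou : fatou_set F base.
Proof.
exists cell; split; last exact: cell_normal.
split; last exact: base_cell.
rewrite openE => z zc; apply/nbhs_nearbyP.
pose gap j := radius - cn (z 0 j - base 0 j).
exists (Num.min (gap 0) (Num.min (gap 1) (gap 2))).
  by rewrite !lt_min !subr_gt0 !zc.
move=> w zw j.
have gj : cn (w 0 j - z 0 j) < gap j.
  apply: lt_le_trans (zw j) _.
  case: j => -[|[|[|//]]] j3; rewrite !ge_min.
  - by rewrite (_ : Ordinal j3 = 0) ?lexx //; apply: val_inj.
  - by rewrite (_ : Ordinal j3 = 1) ?lexx ?orbT //; apply: val_inj.
  - by rewrite (_ : Ordinal j3 = 2) ?lexx ?orbT //; apply: val_inj.
rewrite (_ : _ - _ = (w 0 j - z 0 j) + (z 0 j - base 0 j)); last by ring.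
apply: le_lt_trans (cnD _ _) _.
by move: gj; rewrite /gap; lra.
Qed.

Definition domain : set 'rV[C]_3 := connected_component (fatou_set F) base.

Lemma domain_tracking : domain `<=` tracking_set f a rho.
Proof.
apply: component_tracks.
- exact: bumps_jet.
- exact: bumps_entire.
- exact: rho_bounds.
- exact: base_tracking.
- exact: base_fatou.
Qed.

(** The norm is that of the balls, which are defined entrywise. *)
Lemma coord_le_norm n (v : 'rV[C]_n) j : `|v 0 j| <= `|v|.
Proof.
rewrite real_leNgt ?normr_real //; apply/negP => H.
have : ball_ (fun x : 'rV[C]_n => `|x|) 0 `|v 0 j| v by rewrite /ball_ /= sub0r normrN.
rewrite -mx_norm_ball => -[_ /(_ 0 j)].
by rewrite /ball /= mxE sub0r normrN ltxx.
Qed.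

Lemma domain_escapes z : domain z -> `|iter k F z| @[k --> \oo] --> +oo.
Proof.
move=> /domain_tracking[r r0 zr] A [M [Mreal MA]].
have e0 : 0 < (cn M + 1)^-1 by rewrite invr_gt0 ltr_wpDl ?cn_ge0.
have [N NP] := zr _ e0.
exists N => // n /= Nn; apply: MA.
have [x0 xi _] := NP n z Nn (nearby_refl z r0).
have lower : cn M < cn (orb z n).
  have y0 : 0 < cn (orb z n) by rewrite cn_gt0.
  move: xi; rewrite cnV lef_pV2 ?posrE ?ltr_wpDl ?cn_ge0 // => H; lra.
apply: le_lt_trans (real_ler_norm Mreal) _.
apply: (@lt_le_trans _ _ `|orb z n|); first by rewrite !normE ofR_lt.
exact: coord_le_norm.
Qed.

(** Take n + j a large power of 2, and use [is_pow2_between] for n + k. *)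
Lemma aperiodic_growth j k N : (j < k)%N ->
  exists2 n, (N <= n)%N & growth (n + j) = 3%N /\ growth (n + k) = 2%N.
Proof.
move=> jk; pose i := (N + k)%N; have i_lt : (i < 2 ^ i)%N by rewrite ltn_expl.
have Nj : (N + j <= 2 ^ i)%N by apply: leq_trans (ltnW i_lt); rewrite leq_add2l ltnW.
exists (2 ^ i - j)%N; first by rewrite leq_subRL 1?addnC //; apply: leq_trans Nj; rewrite leq_addl.
have jle : (j <= 2 ^ i)%N by apply: leq_trans Nj; rewrite leq_addl.
rewrite subnK // (_ : 2 ^ i - j + k = 2 ^ i + (k - j))%N; last by lia.
rewrite /growth is_pow2_exp (negbTE (is_pow2_between _)) //.
by rewrite subn_gt0 jk /=; apply: leq_ltn_trans i_lt; rewrite /i; lia.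
Qed.

(** A point z of the component with F^j(z) = F^k(base) has x_(n+j)(z) equal to
    x_(n+k)(base), but the ratios of the two sequences follow the pattern
    shifted by j and by k respectively. *)
Lemma domain_wanders j k : (j < k)%N -> iter k F @` domain <> iter j F @` domain.
Proof.
move=> jk E.
have Db : domain base by apply: connected_component_refl; exact: base_fatou.
have : (iter j F @` domain) (iter k F base) by rewrite -E; exists base.
move=> [z Dz zE].
have [r1 r10 /(_ 4^-1)[]] := domain_tracking Dz; first by rewrite invr_gt0.
move=> N1 H1.
have [r2 r20 /(_ 4^-1)[]] := domain_tracking Db; first by rewrite invr_gt0.
move=> N2 H2.
have [n nN [rj rk]] := aperiodic_growth (maxn N1 N2) jk.
move: nN; rewrite geq_max => /andP[n1 n2].
have [_ _] := H1 (n + j)%N z (leq_trans n1 (leq_addr _ _)) (nearby_refl z r10).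
have [_ _] := H2 (n + k)%N base (leq_trans n2 (leq_addr _ _)) (nearby_refl base r20).
have oE m : orb z (m + j) = orb base (m + k).
  by rewrite addnC -orb_iter zE orb_iter addnC.
rewrite /rho rj rk -!addSn !oE => A B.
set q := orb base (n + k) in A B *.
set y := orb base (n.+1 + k) / q in A B.
have : cn (ofR 3 - ofR 2 : C) <= 4^-1 + 4^-1.
  have -> : ofR 3 - ofR 2 = (y - ofR 2) - (y - ofR 3) :> C by ring.
  by apply: le_trans (cnB _ _) _; exact: lerD.
by rewrite -ofRN -ofRD cn_ofR ger0_norm; lra.
Qed.

Lemma domain_escaping_wandering : escaping_wandering_domain F domain.
Proof.
split; last exact: domain_escapes.
split; last exact: domain_wanders.
by exists base; first exact: base_fatou.
Qed.

End WanderingDomain.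

Theorem theorem4p1 (R : realType) :
  exists (nu : nat) (a : Cplx R) (f : Cplx R -> Cplx R),
    [/\ (1 <= nu <= 2)%N,
        a != 0,
        transcendental_entire f
      & exists U : set 'rV[Cplx R]_3,
          escaping_wandering_domain (@shift_like R 2 nu a f) U].
Proof.
exists 1%N, (ofR (shift_coef R)), (@bumps R); split=> //.
- by rewrite -cn_gt0 cn_ofR normr_gt0 /shift_coef invr_neq0 // pnatr_eq0.
- exact: bumps_transcendental.
- by exists (@domain R); exact: domain_escaping_wandering.
Qed.
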